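(* Let $\mathcal{X},\mathcal{Y}$ be Polish spaces, and consider the partially observed Markov process with transition kernel $T:\mathcal{X}\to\mathcal{P}(\mathcal{X})$ and measurement kernel $Q:\mathcal{X}\to\mathcal{P}(\mathcal{Y})$. Let $\mu,\nu\in\mathcal{P}(\mathcal{X})$ with $\mu\ll\nu$, and assume that $Q$ is dominated. Then for every $n\in\{0,1,2,\dots\}$, $$E^{\mu}\big[\|\pi_{n+1}^{\mu}-\pi_{n+1}^{\nu}\|_{TV}\big]\le(1-\delta(T))(2-\delta(Q))\,E^{\mu}\big[\|\pi_{n}^{\mu}-\pi_{n}^{\nu}\|_{TV}\big],$$ where $\pi_n^\mu$ and $\pi_n^\nu$ are the filters initialized with $\mu$ and $\nu$, respectively.
   Context: $\mathcal{P}(S)$ denotes the set of Borel probability measures on a Polish space $S$. Process: for a prior $\mu\in\mathcal{P}(\mathcal{X})$, $P^\mu$ (with expectation $E^\mu$) is the law on $\mathcal{X}^{\mathbb{Z}_+}\times\mathcal{Y}^{\mathbb{Z}_+}$ of the Markov chain $\{(X_n,Y_n)\}_{n\ge0}$ with $P^\mu((X_0,Y_0)\in A)=\int_A Q(dy|x)\mu(dx)$ and $P^\mu((X_n,Y_n)\in A\mid (X,Y)_{[0,n-1]}=(x,y)_{[0,n-1]})=\int_A Q(dy|x_n)T(dx_n|x_{n-1})$. The kernels are time invariant. Write $T(\pi)(dx')=\int_{\mathcal{X}}T(dx'|x)\pi(dx)$ for a measure $\pi$ on $\mathcal{X}$. Dominated: $Q$ is dominated if there is $\lambda\in\mathcal{P}(\mathcal{Y})$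 with $Q(dy|x)\ll\lambda$ for every $x\in\mathcal{X}$; $g(x,y)=\frac{dQ(\cdot|x)}{d\lambda}(y)$ denotes the (jointly measurable) likelihood function. Bayesian update operator: $\psi(\pi,y)(dx)=\frac{g(x,y)\pi(dx)}{\int_{\mathcal{X}}g(x',y)\pi(dx')}$ if the denominator is positive, and $\psi(\pi,y)=0$ (zero measure) otherwise. Filter: $\pi_n^\mu(\cdot)=P^\mu(X_n\in\cdot\mid Y_{[0,n]})$, where $Y_{[0,n]}=(Y_0,\dots,Y_n)$. It is computed recursively by $\pi_0^\mu=\psi(\mu,Y_0)$, $\pi_{n+1}^\mu=\psi(T(\pi_n^\mu),Y_{n+1})$. The incorrectly initialized filter $\pi_n^\nu$ is computed by the same recursion started from $\pi_0^\nu=\psi(\nu,Y_0)$, using the same measurements; in $E^\mu$ the measurements are generated under $P^\mu$. Total variation norm: $\|P-P'\|_{TV}=\sup_{\|f\|_\infty\le 1}\left|\int f\,dP-\int f\,dP'\right|$, the supremum being over measurable real functions $f$ with $\|f\|_\infty\le1$. Dobrushin coefficient: for a probability kernel $K:S_1\to\mathcal{P}(S_2)$, $\delta(K)=\inf\sum_{i=1}^{m}\min(K(x,A_i),K(x',A_i))$, where the infimum is over all $x,x'\in S_1$ and all finite measurable partitions $\{A_i\}_{i=1}^m$ of $S_2$. *)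

(* Defs.v *)
From HB Require Import structures.
From mathcomp Require Import all_boot all_order all_algebra.
From mathcomp Require Import all_classical all_reals all_analysis.
From mathcomp Require Import measurable_realfun.

Set Implicit Arguments.
Unset Strict Implicit.
Unset Printing Implicit Defensive.

Import Order.TTheory GRing.Theory Num.Theory.
Import numFieldNormedType.Exports.

Local Open Scope classical_set_scope.
Local Open Scope ring_scope.
Local Open Scope ereal_scope.

(* Separable and completely metrizable; the metric is existentially quantified,
   only the topology of S is part of the data. *)
Definition polish (R : realType) (S : topologicalType) : Prop :=
  (exists D : set S, countable D /\ dense D) /\
  exists dist : S -> S -> R,
    [/\ forall x y, dist x y = 0%R <-> x = y,
        forall x y, dist x y = dist y x,
        forall x y z, (dist x z <= dist x y + dist y z)%R,
        forall (x : S) (A : set S), nbhs x A <->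
          exists2 e : R, (0 < e)%R & [set y | (dist x y < e)%R] `<=` A &
        forall u : nat -> S,
          (forall e : R, (0 < e)%R -> exists N : nat,
            forall m n, (N <= m)%N -> (N <= n)%N -> (dist (u m) (u n) < e)%R) ->
          exists l : S, u @ \oo --> l].

Notation borel S := (g_sigma_algebraType (@open S)).

Section total_variation.
Context d (S : measurableType d) (R : realType).

Definition tv_dist (m1 m2 : {measure set S -> \bar R}) : \bar R :=
  ereal_sup [set `| \int[m1]_x (f x)%:E - \int[m2]_x (f x)%:E |
            | f in [set f : S -> R | measurable_fun [set: S] f /\
                                     forall x, (`|f x| <= 1)%R]].

End total_variation.

Section dobrushin.
Context d1 d2 (S1 : measurableType d1) (S2 : measurableType d2) (R : realType).

Definition dobrushin (K : R.-pker S1 ~> S2) : \bar R :=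
  ereal_inf [set r : \bar R |
    exists (x x' : S1) (m : nat) (A : 'I_m -> set S2),
      [/\ forall i, measurable (A i),
          trivIset [set: 'I_m] A,
          \bigcup_(i in [set: 'I_m]) A i = [set: S2] &
          r = \sum_(i < m) Order.min (K x (A i)) (K x' (A i))]].

End dobrushin.

Section channel_likelihood.
Context dX dY (X : measurableType dX) (Y : measurableType dY) (R : realType).
Variables (Q : R.-pker X ~> Y) (lam : probability Y R).

Definition channel_dominated : Prop := forall x, Q x `<< lam.

(* A jointly measurable version of (x, y) |-> (dQ(.|x) / dlam)(y). *)
Record likelihood := Likelihood {
  lik :> X -> Y -> R ;
  lik_ge0 : forall x y, (0 <= lik x y)%R ;
  measurable_lik : measurable_fun [set: X * Y] (fun xy => lik xy.1 xy.2) ;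
  lik_density : forall x (B : set Y), measurable B ->
    Q x B = \int[lam]_(y in B) (lik x y)%:E }.

End channel_likelihood.

Section bayes_update.
Context dX dY (X : measurableType dX) (Y : measurableType dY) (R : realType).
Variables (Q : R.-pker X ~> Y) (lam : probability Y R) (g : likelihood Q lam).
Variables (pi : {measure set X -> \bar R}) (y : Y).

(* If the normalizing integral is +oo, the quotient is 0 because +oo^-1 = 0;
   for a probability pi this only concerns a lam-null set of y. *)
Definition bayes (A : set X) : \bar R :=
  if 0 < \int[pi]_x (g x y)%:E then
    (\int[pi]_(x in A) (g x y)%:E) / (\int[pi]_x (g x y)%:E)
  else 0.

Let bayes0 : bayes set0 = 0.
Proof. by rewrite /bayes; case: ifP => // _; rewrite integral_set0 mul0e. Qed.

Let bayes_ge0 A : 0 <= bayes A.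
Proof.
rewrite /bayes; case: ifP => // D0; rewrite mule_ge0 ?inve_ge0//; last exact: ltW.
by apply: integral_ge0 => x _; rewrite lee_fin lik_ge0.
Qed.

Let bayes_sigma_additive : semi_sigma_additive bayes.
Proof.
move=> F mF tF mUF; rewrite /bayes; case: ifP => D0; last first.
  by under eq_fun do rewrite big1//; exact: cvg_cst.
set D := \int[pi]_x _ in D0 *.
have DV : D^-1 \is a fin_num.
  by rewrite ge0_fin_numE ?inve_ge0 ?ltW// lt_neqAle leey inve_eqy gt_eqF.
have int_ge0 A : 0 <= \int[pi]_(x in A) (g x y)%:E.
  by apply: integral_ge0 => x _; rewrite lee_fin lik_ge0.
rewrite [X in X @ _ --> _](_ : _ = fun n =>
    (\sum_(0 <= i < n) \int[pi]_(x in F i) (g x y)%:E) * D^-1); last first.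
  by apply/funext => n; rewrite ge0_sume_distrl.
apply: cvgeZr => //; apply: semi_sigma_additive_nng_induced => //.
- by apply/measurable_EFinP; exact: measurable_fun_pair1 (measurable_lik g).
- by move=> x; exact: lik_ge0.
Qed.

HB.instance Definition _ := isMeasure.Build _ _ _ bayes
  bayes0 bayes_ge0 bayes_sigma_additive.

End bayes_update.

Section prediction.
Context dX (X : measurableType dX) (R : realType).
Variables (T : R.-pker X ~> X) (pi : {measure set X -> \bar R}).

Definition predict (A : set X) : \bar R := \int[pi]_x T x A.

Let predict0 : predict set0 = 0.
Proof. by apply: integral0_eq => x _; rewrite measure0. Qed.

Let predict_ge0 A : 0 <= predict A.
Proof. exact: integral_ge0. Qed.

Let predict_sigma_additive : semi_sigma_additive predict.
Proof.
move=> F mF tF mUF.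
rewrite [X in _ --> X](_ : _ = \int[pi]_x (\sum_(n <oo) T x (F n))); last first.
  apply: eq_integral => x _.
  by apply/esym/cvg_lim => //; exact/measure_semi_sigma_additive.
apply/cvg_closeP; split.
  by apply: is_cvg_nneseries => n _ _; exact: integral_ge0.
by rewrite closeE// integral_nneseries// => n; exact: measurable_kernel.
Qed.

HB.instance Definition _ := isMeasure.Build _ _ _ predict
  predict0 predict_ge0 predict_sigma_additive.

End prediction.

Section filter_recursion.
Context dX dY (X : measurableType dX) (Y : measurableType dY) (R : realType).
Variables (T : R.-pker X ~> X) (Q : R.-pker X ~> Y).
Variables (lam : probability Y R) (g : likelihood Q lam).

Fixpoint filter_rec (nu : {measure set X -> \bar R}) (y : nat -> Y) (n : nat) :
    {measure set X -> \bar R} :=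
  match n with
  | 0 => bayes g nu (y 0%N)
  | k.+1 => bayes g (predict T (filter_rec nu y k)) (y k.+1)
  end.

End filter_recursion.

Section conditional_law.
Context d dE dS (Omega : measurableType d) (E : measurableType dE)
  (S : measurableType dS) (R : realType).
Variable P : probability Omega R.

(* P(Z \in A | H) = k(H, A) almost surely, for every measurable A. *)
Definition cond_law (Z : Omega -> S) (H : Omega -> E)
    (k : E -> set S -> \bar R) : Prop :=
  forall (A : set S) (B : set E), measurable A -> measurable B ->
    P (H @^-1` B `&` Z @^-1` A) = \int[P]_(w in H @^-1` B) k (H w) A.

End conditional_law.

Section process.
Context d dX dY (Omega : measurableType d) (X : measurableType dX)
  (Y : measurableType dY) (R : realType).
Variables (T : R.-pker X ~> X) (Q : R.-pker X ~> Y).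

(* A |-> \int_A Q(dy | x) pi(dx) *)
Definition joint_law (pi : {measure set X -> \bar R}) (A : set (X * Y)) : \bar R :=
  \int[pi]_x \int[Q x]_y (\1_A (x, y))%:E.

Variables (P : probability Omega R).
Variables (x_ : nat -> {RV P >-> X}) (y_ : nat -> {RV P >-> Y}).

Definition history (n : nat) (w : Omega) : n.-tuple (X * Y) :=
  [tuple (x_ i w, y_ i w) | i < n].

Definition measurements (n : nat) (w : Omega) : n.-tuple Y :=
  [tuple y_ i w | i < n].

(* Under P, the process (x_ n, y_ n) has law P^mu. *)
Definition pomp (mu : probability X R) : Prop :=
  (forall A : set (X * Y), measurable A ->
     P ((fun w => (x_ 0%N w, y_ 0%N w)) @^-1` A) = joint_law mu A) /\
  (forall n : nat,
     cond_law P (fun w => (x_ n.+1 w, y_ n.+1 w)) (history n.+1)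
       (fun h => joint_law (T (tnth h ord_max).1))).

(* pi n is a version of the regular conditional distribution of x_ n given
   y_ 0, ..., y_ n. *)
Definition is_filter (pi : forall n : nat, R.-pker (n.+1.-tuple Y) ~> X) : Prop :=
  forall n : nat, cond_law P (x_ n) (measurements n.+1) (fun y => pi n y).

End process.

(* Main.v *)
Require Import Defs.
From HB Require Import structures.
From mathcomp Require Import all_boot all_order all_algebra.
From mathcomp Require Import all_classical all_reals all_analysis.
From mathcomp Require Import measurable_realfun ring lra.
Import Order.TTheory GRing.Theory Num.Theory.
Import numFieldNormedType.Exports.

Set Implicit Arguments.
Unset Strict Implicit.
Unset Printing Implicit Defensive.

Local Open Scope classical_set_scope.
Local Open Scope ring_scope.
Local Open Scope ereal_scope.

(** One step of the filter is a prediction followed by a Bayesian update, and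
    each half acts on the total variation distance by a factor of its own.

    Prediction.  For probabilities p and r let a and b be the Jordan parts of
    p - r.  They have the same mass, and their masses add up to the distance
    ([tv_distE]).  If a function phi oscillates by at most c, then replacing phi
    by phi - inf phi shows that its integrals against p and r differ by at most
    c times the mass of a, that is, by half of c times the distance
    ([integral_diff_le_osc]).  Two-block partitions in the definition of the
    Dobrushin coefficient show that K x A oscillates by at most
    1 - dobrushin K in x, so K contracts the distance by that factor
    ([kernel_integral_diff_le], [tv_dist_predict]).

    Update.  Let N_p y be the integral of g x y against p (dx), the density of
    the observation when the state has law p.  With a and b as above,
      N_p y * tv (bayes p y, bayes r y)
        <= N_a y + N_b y + |N_p y - N_r y|
    ([tv_dist_bayes_le]).  Integrated against lam, N_a + N_b gives the mass of
    a + b, which is the distance of p and r because each g x is a probability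
    density; the last term compares two observation laws and is at most
    1 - dobrushin Q times that distance by the contraction property of Q.  The
    sum is the factor 2 - dobrushin Q ([integral_tv_dist_bayes_le]).  Given the
    past, the next observation has density N_p with p the predicted law of the
    state, so the weight N_p is the one that the expectation supplies
    ([observation_integral], [posterior_tv_dist_le]).

    Two points need care.  A kernel contracts only differences of equal masses,
    hence the filter started from nu has to be a probability almost surely.
    This is the role of mu << nu: domination of the true filter by the other
    one propagates through both half-steps, and under domination N_r y = 0
    forces N_p y = 0, which is a null event for the observation
    ([posterior_dominates], [filter_dominates]).  Moreover the distance is a
    supremum over an uncountable family.  The Borel sets of a Polish space are
    generated by a countable algebra, and the supremum may be taken over that
    algebra ([tv_generating_algebra]); this makes the integrands measurable and
    reduces the almost sure identity between the conditional law of the state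
    and the Bayes update of its predicted law to countably many sets
    ([posterior_bayes]). *)

(** * Measures *)

Lemma integral_indicE d (Z : measurableType d) (R : realType)
    (m : {measure set Z -> \bar R}) (D : set Z) (f : Z -> \bar R) :
  \int[m]_(z in D) f z = \int[m]_z ((\1_D z)%:E * f z).
Proof.
rewrite integral_mkcond; apply: eq_integral => z _.
by rewrite patchE indicE; case: ifPn => _; rewrite ?mul1e ?mul0e.
Qed.

Lemma measurable_EFin_indic d (Z : measurableType d) (R : realType) (D : set Z) :
  measurable D -> measurable_fun [set: Z] (fun z => (\1_D z)%:E : \bar R).
Proof. by move=> mD; apply/measurable_EFinP; exact: measurable_indic. Qed.

Lemma measure1_nonempty d (Z : measurableType d) (R : realType)
    (m : {measure set Z -> \bar R}) : m [set: Z] = 1 -> [set: Z] !=set0.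
Proof.
move=> m1; apply/set0P/eqP => Z0; move: m1.
by rewrite Z0 measure0 => /eqP; rewrite eqe eq_sym oner_eq0.
Qed.

(** The integrand vanishes r-almost everywhere, hence p-almost everywhere. *)
Lemma null_dominates_integral_eq0 d (Z : measurableType d) (R : realType)
    (p r : {measure set Z -> \bar R}) (A : set Z) (f : Z -> \bar R) :
  p `<< r -> measurable A -> (forall z, 0 <= f z) -> measurable_fun [set: Z] f ->
  \int[r]_(z in A) f z = 0 -> \int[p]_(z in A) f z = 0.
Proof.
move=> pr mA f0 mf r0; have mfA : measurable_fun A f by exact: measurable_funTS.
have absE (m : {measure set Z -> \bar R}) :
    \int[m]_(z in A) f z = \int[m]_(z in A) `|f z|.
  by apply: eq_integral => z _; rewrite gee0_abs.
rewrite absE; apply/(ae_eq_integral_abs p mA mfA).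
apply: (null_dominates_ae_eq mA pr).
by apply/(ae_eq_integral_abs r mA mfA); rewrite -absE.
Qed.

Section mixture.
Context d1 d2 (W : measurableType d1) (Z : measurableType d2) (R : realType).
Variables (m : {measure set W -> \bar R}) (k : W -> {measure set Z -> \bar R}).
Variables (q : {measure set Z -> \bar R}).
Hypothesis mk : forall A, measurable A -> measurable_fun [set: W] (k ^~ A).
Hypothesis qE : forall A, measurable A -> q A = \int[m]_w k w A.

Import HBNNSimple.

Let integral_mixture_nnsfun (h : {nnsfun Z >-> R}) :
  \int[q]_z (h z)%:E = \int[m]_w \int[k w]_z (h z)%:E.
Proof.
rewrite integralT_nnsfun sintegralE.
under [RHS]eq_integral do rewrite integralT_nnsfun sintegralE.
rewrite ge0_integral_fsum//.
- apply: eq_fsbigr => r _; rewrite qE//.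
  have [r0|r0] := leP 0%R r; first by rewrite ge0_integralZl//; exact: mk.
  rewrite !integral0_eq ?mule0// => w _.
    by rewrite preimage_nnfun0// measure0 mule0.
  by rewrite preimage_nnfun0// measure0.
- by move=> r; apply: measurable_funeM; exact: mk.
- by move=> r w _; by apply: (mulemu_ge0 (fun r => h @^-1` [set r])); exact: preimage_nnfun0.
Qed.

Lemma integral_mixture (f : Z -> \bar R) : (forall z, 0 <= f z) ->
  measurable_fun [set: Z] f -> \int[q]_z f z = \int[m]_w \int[k w]_z f z.
Proof.
move=> f0 mf; pose f_ := nnsfun_approx measurableT mf.
have fE (p : {measure set Z -> \bar R}) :
    \int[p]_z f z = limn (fun n => \int[p]_z (f_ n z)%:E).
  rewrite -monotone_convergence//.
  - by apply: eq_integral => z _; apply/esym/cvg_lim => //; exact: cvg_nnsfun_approx.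
  - by move=> n; exact/measurable_EFinP.
  - by move=> n z _; rewrite lee_fin.
  - by move=> z _ a b ab; rewrite lee_fin; exact/lefP/nd_nnsfun_approx.
rewrite fE; under eq_fun do rewrite integral_mixture_nnsfun.
rewrite -monotone_convergence//.
- by apply: eq_integral => w _; rewrite fE.
- move=> n; apply: measurable_fun_integral_kernel => //.
  + by move=> z; rewrite lee_fin.
  + exact/measurable_EFinP.
- by move=> n w _; apply: integral_ge0 => z _; rewrite lee_fin.
- move=> w _ a b ab; apply: ge0_le_integral => //.
  + by move=> z _; rewrite lee_fin.
  + exact/measurable_EFinP.
  + exact/measurable_EFinP.
  + by move=> z _; rewrite lee_fin; exact/lefP/nd_nnsfun_approx.
Qed.

End mixture.

(** A measure with density gam is the mixture of the Dirac masses weighted by gam. *)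
Lemma integral_density d (Z : measurableType d) (R : realType)
    (m q : {measure set Z -> \bar R}) (gam : Z -> R) :
  (forall z, 0 <= gam z)%R -> measurable_fun [set: Z] gam ->
  (forall A, measurable A -> q A = \int[m]_(z in A) (gam z)%:E) ->
  forall h, (forall z, 0 <= h z) -> measurable_fun [set: Z] h ->
  \int[q]_z h z = \int[m]_z (h z * (gam z)%:E).
Proof.
move=> gam0 mgam qE h h0 mh.
pose k z : {measure set Z -> \bar R} := mscale (NngNum (gam0 z)) (\d_z).
have kE z A : k z A = (gam z)%:E * (\1_A z)%:E.
  by rewrite /k /= /mscale /= diracE indicE.
rewrite (@integral_mixture _ _ _ _ _ m k)//.
- apply: eq_integral => z _.
  by rewrite ge0_integral_mscale//= integral_dirac// diracT mul1e muleC.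
- move=> A mA; under eq_fun do rewrite kE.
  apply: emeasurable_funM; first exact/measurable_EFinP.
  by apply/measurable_EFinP; exact: measurable_indic.
- move=> A mA; rewrite qE// integral_mkcond; apply: eq_integral => z _.
  by rewrite kE patchE indicE; case: ifPn => _; rewrite ?mule1 ?mule0.
Qed.

Lemma integral_mrestr d (Z : measurableType d) (R : realType)
    (m : {measure set Z -> \bar R}) (D : set Z) (mD : measurable D) (f : Z -> \bar R) :
  (forall z, 0 <= f z) -> measurable_fun [set: Z] f ->
  \int[mrestr m mD]_z f z = \int[m]_(z in D) f z.
Proof.
move=> f0 mf; rewrite (@integral_density _ _ _ m _ (\1_D : Z -> R))//.
  by rewrite [RHS]integral_indicE; apply: eq_integral => z _; rewrite muleC.
by move=> A mA; rewrite integral_indic// setIC.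
Qed.

Section mixture_measure.
Context d1 d2 (W : measurableType d1) (Z : measurableType d2) (R : realType).
Variables (m : {measure set W -> \bar R}) (k : W -> {measure set Z -> \bar R}).
Hypothesis mk : forall A, measurable A -> measurable_fun [set: W] (k ^~ A).

(** The measurability of the kernel is an argument of the set function so that
    the measure structure can be inferred from the term alone. *)
Definition mixture
    (_ : forall A, measurable A -> measurable_fun [set: W] (k ^~ A))
    (A : set Z) : \bar R := \int[m]_w k w A.

Let mixture0 : mixture mk set0 = 0.
Proof. by apply: integral0_eq => w _; rewrite measure0. Qed.

Let mixture_ge0 A : 0 <= mixture mk A.
Proof. exact: integral_ge0. Qed.

Let mixture_sigma_additive : semi_sigma_additive (mixture mk).
Proof.
move=> F mF tF mUF.
rewrite [X in _ --> X](_ : _ = \int[m]_w (\sum_(n <oo) k w (F n))); last first.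
  apply: eq_integral => w _.
  by apply/esym/cvg_lim => //; exact/measure_semi_sigma_additive.
apply/cvg_closeP; split.
  by apply: is_cvg_nneseries => n _ _; exact: integral_ge0.
by rewrite closeE// integral_nneseries// => n; exact: mk.
Qed.

HB.instance Definition _ := isMeasure.Build _ _ _ (mixture mk)
  mixture0 mixture_ge0 mixture_sigma_additive.

End mixture_measure.

Section image_measure.
Context d1 d2 (W : measurableType d1) (Z : measurableType d2) (R : realType).
Variables (m : {measure set W -> \bar R}) (f : W -> Z).
Hypothesis mf : measurable_fun [set: W] f.

Lemma measurable_dirac_comp A : measurable A ->
  measurable_fun [set: W] (fun w => \d_(f w) A : \bar R).
Proof.
move=> mA; under eq_fun do rewrite diracE -indicE.
apply/measurable_EFinP; apply: measurableT_comp mf; exact: measurable_indic.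
Qed.

(** Written as a mixture of Dirac masses, so that change of variables is an
    instance of [integral_mixture]. *)
Definition image_measure : {measure set Z -> \bar R} :=
  mixture m measurable_dirac_comp.

Lemma image_measureE A : measurable A -> image_measure A = m (f @^-1` A).
Proof.
move=> mA; rewrite /image_measure /= /mixture.
rewrite (eq_integral (fun w => (\1_(f @^-1` A) w)%:E)); last first.
  by move=> w _; rewrite /= diracE indicE; congr (_%:R%:E); exact/idP/idP.
rewrite integral_indic ?setIT//.
by rewrite -[X in measurable X]setTI; exact: mf.
Qed.

Lemma integral_image_measure (h : Z -> \bar R) : (forall z, 0 <= h z) ->
  measurable_fun [set: Z] h ->
  \int[image_measure]_z h z = \int[m]_w h (f w).
Proof.
move=> h0 mh; rewrite (integral_mixture (m := m) measurable_dirac_comp)//.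
by apply: eq_integral => w _; rewrite integral_dirac// diracT mul1e.
Qed.

End image_measure.

Section density.
Context d (Z : measurableType d) (R : realType).
Variables (m : {measure set Z -> \bar R}) (f : Z -> \bar R).
Hypotheses (f0 : forall z, 0 <= f z) (mf : measurable_fun [set: Z] f).

Definition density (_ : forall z, 0 <= f z) (_ : measurable_fun [set: Z] f)
  (A : set Z) : \bar R := \int[m]_(z in A) f z.

Let density0 : density f0 mf set0 = 0. Proof. exact: integral_set0. Qed.

Let density_ge0 A : 0 <= density f0 mf A. Proof. exact: integral_ge0. Qed.

HB.instance Definition _ := isMeasure.Build _ _ _ (density f0 mf)
  density0 density_ge0 (semi_sigma_additive_nng_induced mf f0).

End density.

(** Rectangles form a pi-system that generates the product sigma-algebra. *)
Lemma eq_measure_rectangles d1 d2 (S : measurableType d1) (W : measurableType d2)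
    (R : realType) (m1 m2 : {measure set (S * W) -> \bar R}) :
  m1 [set: S * W] < +oo ->
  (forall B C, measurable B -> measurable C -> m1 (B `*` C) = m2 (B `*` C)) ->
  forall E, measurable E -> m1 E = m2 E.
Proof.
move=> m1fin m12.
pose G : set (set (S * W)) :=
  [set C | exists A, measurable A /\ exists B, measurable B /\ C = A `*` B].
apply: (measure_unique G (fun=> setT)) => //.
- rewrite measurable_prod_measurableType; congr (<<s _ >>).
  rewrite predeqE; split => [[A mA [B mB <-]]|[A [mA [B [mB ->]]]]].
    by exists A; split => //; exists B.
  by exists A => //; exists B.
- move=> _ _ [X1 [mX1 [X2 [mX2 ->]]]] [Y1 [mY1 [Y2 [mY2 ->]]]].
  rewrite -setXI; exists (X1 `&` Y1); split; first exact: measurableI.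
  by exists (X2 `&` Y2); split => //; exact: measurableI.
- by move=> _; exists setT; split => //; exists setT; split => //; rewrite setXTT.
- by rewrite bigcup_const//; exists 0%N.
- by move=> _ [A [mA [B [mB ->]]]]; exact: m12.
Qed.

(** * Total variation distance *)

Lemma fin_num_measure_lty d (S : measurableType d) (R : realType)
    (p : {measure set S -> \bar R}) A :
  p [set: S] < +oo -> measurable A -> p A \is a fin_num.
Proof.
move=> p1 mA; rewrite ge0_fin_numE//; apply: le_lt_trans p1.
by apply: le_measure; rewrite ?inE.
Qed.

Lemma sube_eq_adde (R : realDomainType) (p r a b : \bar R) :
  p \is a fin_num -> r \is a fin_num -> a \is a fin_num -> b \is a fin_num ->
  p - r = a - b -> p + b = r + a.
Proof.
case: p r a b => [p| |] [r| |] [a| |] [b| |]// _ _ _ _ [e].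
by rewrite -!EFinD; congr EFin; lra.
Qed.

Section finite_copy.
Context d (S : measurableType d) (R : realType).
Variables (p : {measure set S -> \bar R}) (pfin : p [set: S] < +oo).

(** A synonym of p on which finiteness is part of the structure; the kernel and
    filter values met below are plain measures whose finiteness is proved
    separately. *)
Definition finite_copy (_ : p [set: S] < +oo) : set S -> \bar R := p.

HB.instance Definition _ := isMeasure.Build _ _ _ (finite_copy pfin)
  (measure0 p) (measure_ge0 p) (@measure_semi_sigma_additive _ _ _ p).

HB.instance Definition _ := Measure_isFinite.Build _ _ _ (finite_copy pfin)
  (fun A mA => fin_num_measure_lty pfin mA).

End finite_copy.

Section total_variation.
Context d (S : measurableType d) (R : realType).
Implicit Types (p r a b : {measure set S -> \bar R}).

(** The Jordan decomposition of the charge p - r, stated additively to avoid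
    subtractions of extended reals; P is its Hahn positive set. *)
Lemma jordan_measures p r : p [set: S] < +oo -> r [set: S] < +oo ->
  exists P, exists a b : {measure set S -> \bar R},
  [/\ measurable P, a [set: S] < +oo, b [set: S] < +oo,
    forall A, measurable A -> p A + b A = r A + a A &
    a [set: S] + b [set: S] = (p P - r P) + (r (~` P) - p (~` P)) ].
Proof.
move=> pfin rfin.
pose nu : {charge set S -> \bar R} := cadd
  (charge_of_finite_measure (finite_copy pfin))
  (cscale (-1) (charge_of_finite_measure (finite_copy rfin))).
have nuE A : nu A = p A - r A.
  by rewrite /nu /= /cadd /= cscaleN1.
have [P [N PN]] := Hahn_decomposition nu.
have [[mP _] [mN _] PUN PIN] := PN.
have NE : N = ~` P.
  apply/seteqP; split => x Nx; first by move=> Px; have : (P `&` N) x by []; rewrite PIN.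
  have : (P `|` N) x by rewrite PUN.
  by case.
have aE A : measurable A -> jordan_pos PN A = nu (A `&` P).
  by move=> mA; rewrite jordan_posE cjordan_posE /crestr0 mem_set.
have bE A : measurable A -> jordan_neg PN A = - nu (A `&` N).
  by move=> mA; rewrite jordan_negE cjordan_negE /crestr0 mem_set.
have mNP := measurableC mP.
exists P, (jordan_pos PN), (jordan_neg PN); split => //.
- by rewrite ltey_eq fin_num_measure.
- by rewrite ltey_eq fin_num_measure.
- move=> A mA; have : p A - r A = jordan_pos PN A - jordan_neg PN A.
    by rewrite -nuE (jordan_decomp PN mA) /cadd /= cscaleN1.
  have pA := fin_num_measure_lty pfin mA; have rA := fin_num_measure_lty rfin mA.
  by move=> e; apply: sube_eq_adde e => //; exact: fin_num_measure.
- have -> : jordan_pos PN [set: S] + jordan_neg PN [set: S] =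
      nu P - nu N by rewrite aE// bE// !setTI.
  rewrite !nuE NE.
  have [pP rP] := (fin_num_measure_lty pfin mP, fin_num_measure_lty rfin mP).
  have [pN rN] := (fin_num_measure_lty pfin mNP, fin_num_measure_lty rfin mNP).
  rewrite -(fineK pP) -(fineK rP) -(fineK pN) -(fineK rN) -!EFinB -?EFinD.
  by congr EFin; lra.
Qed.

(** The test function is 1 on A and -1 off A. *)
Lemma tv_dist_ge p r A : p [set: S] < +oo -> r [set: S] < +oo -> measurable A ->
  (p A - r A) + (r (~` A) - p (~` A)) <= tv_dist p r.
Proof.
move=> pfin rfin mA.
pose f : S -> R := fun x => (\1_A x - \1_(~` A) x)%R.
have mf : measurable_fun [set: S] f.
  by apply: measurable_funB; apply: measurable_indic => //; exact: measurableC.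
have mCA := measurableC mA.
have intf (m : {measure set S -> \bar R}) : m [set: S] < +oo ->
    \int[m]_x (f x)%:E = m A - m (~` A).
  move=> mfin; rewrite (_ : (fun x => (f x)%:E) =
    (fun x => (\1_A x)%:E) \- (fun x => (\1_(~` A) x)%:E))//.
  have inti B : measurable B -> m.-integrable [set: S] (fun x => (\1_B x)%:E).
    move=> mB; apply: measurable_bounded_integrable => //.
    exists 1%R; split => // M M1 x _.
    by rewrite /= indicE; apply: le_trans (ltW M1); rewrite normr_nat; case: (x \in B).
  rewrite integralB//; [|exact: inti|exact: inti].
  by rewrite !integral_indic// !setIT.
apply: le_ereal_sup_tmp; exists `|\int[p]_x (f x)%:E - \int[r]_x (f x)%:E|.
  exists f => //; split => // x.
  rewrite /f !indicE in_setC; case: (x \in A) => /=.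
    by rewrite subr0 normr1.
  by rewrite sub0r normrN1.
rewrite !intf//.
have pA := fin_num_measure_lty pfin mA; have rA := fin_num_measure_lty rfin mA.
have pC := fin_num_measure_lty pfin mCA; have rC := fin_num_measure_lty rfin mCA.
rewrite -(fineK pA) -(fineK rA) -(fineK pC) -(fineK rC) -!EFinB -?EFinD.
rewrite abse_EFin lee_fin; apply: le_trans (ler_norm _); lra.
Qed.

Lemma ge0_integral_add_eq p r a b (D : set S) (f : S -> \bar R) :
  (forall A, measurable A -> p A + b A = r A + a A) ->
  measurable D -> measurable_fun [set: S] f -> (forall x, 0 <= f x) ->
  \int[p]_(x in D) f x + \int[b]_(x in D) f x =
  \int[r]_(x in D) f x + \int[a]_(x in D) f x.
Proof.
move=> pbra mD mf f0; have mfD : measurable_fun D f by exact: measurable_funTS.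
rewrite -ge0_integral_measure_add// -ge0_integral_measure_add//.
apply: eq_measure_integral => A mA _.
by rewrite /measure_add/= /msum !big_ord_recl !big_ord0 /= !adde0 pbra.
Qed.

(** By [ge0_integral_add_eq] the difference equals the difference of the
    integrals against a and b when these are finite; otherwise the bound is
    trivial. *)
Lemma ge0_integral_diff_le p r a b (D : set S) (f : S -> \bar R) :
  (forall A, measurable A -> p A + b A = r A + a A) ->
  measurable D -> measurable_fun [set: S] f -> (forall x, 0 <= f x) ->
  \int[p]_(x in D) f x < +oo -> \int[r]_(x in D) f x < +oo ->
  `|\int[p]_(x in D) f x - \int[r]_(x in D) f x| <=
  \int[a]_(x in D) f x + \int[b]_(x in D) f x.
Proof.
move=> pbra mD mf f0 pf rf.
have := ge0_integral_add_eq pbra mD mf f0.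
have P0 (m : {measure set S -> \bar R}) : 0 <= \int[m]_(x in D) f x.
  by apply: integral_ge0 => x _.
move: pf rf (P0 p) (P0 r) (P0 a) (P0 b).
case: (\int[p]_(x in D) f x) => [p'| |]// _.
case: (\int[r]_(x in D) f x) => [r'| |]// _ _ _.
case: (\int[a]_(x in D) f x) => [a'| |]//; last first.
  by move=> _; case: (\int[b]_(x in D) f x) => [b'| |]// _ _; exact: leey.
case: (\int[b]_(x in D) f x) => [b'| |]//.
rewrite !lee_fin => a0 b0 [e].
rewrite ler_norml; apply/andP; split; lra.
Qed.

(** A test function bounded by 1 is at most the mass of the Jordan parts, by the
    previous bound on its positive and negative parts; the sign function of the
    Hahn set attains that mass. *)
Lemma tv_distE p r : p [set: S] < +oo -> r [set: S] < +oo ->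
  exists P, exists a b : {measure set S -> \bar R},
  [/\ measurable P, a [set: S] < +oo, b [set: S] < +oo,
    forall A, measurable A -> p A + b A = r A + a A &
    tv_dist p r = a [set: S] + b [set: S] /\
    tv_dist p r = (p P - r P) + (r (~` P) - p (~` P)) ].
Proof.
move=> pfin rfin; have [P [a [b [mP afin bfin pbra abE]]]] := jordan_measures pfin rfin.
(* the mass of the Jordan parts is already attained on P, by [tv_dist_ge] *)
suff tvE : tv_dist p r = a [set: S] + b [set: S].
  by exists P, a, b; split => //; split => //; rewrite tvE.
apply/eqP; rewrite eq_le; apply/andP; split; last by rewrite abE; exact: tv_dist_ge.
apply: ge_ereal_sup => _ [f [mf f1] <-].
have mfp : measurable_fun [set: S] (EFin \o f)^\+ by exact/measurable_funepos/measurable_EFinP.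
have mfn : measurable_fun [set: S] (EFin \o f)^\- by exact/measurable_funeneg/measurable_EFinP.
have fp1 x : (EFin \o f)^\+ x <= 1.
  by rewrite funeposE ge_max lee01 andbT lee_fin (le_trans (ler_norm _)).
have fn1 x : (EFin \o f)^\- x <= 1.
  by rewrite funenegE ge_max lee01 andbT lee_fin (le_trans (ler_norm _))// normrN.
have intfin (m : {measure set S -> \bar R}) h : m [set: S] < +oo ->
    measurable_fun [set: S] h -> (forall x, 0 <= h x) -> (forall x, h x <= 1) ->
    \int[m]_x h x < +oo /\ exists c, \int[m]_x h x = c%:E.
  move=> mfin mh h0 h1; have foo : \int[m]_x h x < +oo.
    apply: le_lt_trans mfin; rewrite -[leRHS]mul1e -integral_cst//.
    by apply: ge0_le_integral.
  split => //; exists (fine (\int[m]_x h x)); rewrite fineK// ge0_fin_numE//.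
  by apply: integral_ge0 => x _.
have intp (m : {measure set S -> \bar R}) (mfin : m [set: S] < +oo) :=
  intfin m _ mfin mfp (fun x => funepos_ge0 _ x) fp1.
have intn (m : {measure set S -> \bar R}) (mfin : m [set: S] < +oo) :=
  intfin m _ mfin mfn (fun x => funeneg_ge0 _ x) fn1.
have abs1 (m : {measure set S -> \bar R}) :
    \int[m]_x (EFin \o f)^\+ x + \int[m]_x (EFin \o f)^\- x <= m [set: S].
  rewrite -ge0_integralD//.
  rewrite -[leRHS]mul1e -integral_cst//.
  apply: ge0_le_integral => //.
  - by move=> x _; apply: adde_ge0.
  - exact: emeasurable_funD.
  - by move=> x _; rewrite -[_ + _]/(((EFin \o f)^\+ \+ (EFin \o f)^\-) x) -fune_abse /= lee_fin.
apply: le_trans (leeD (abs1 a) (abs1 b)).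
have := ge0_integral_diff_le pbra measurableT mfp (fun x => funepos_ge0 _ x)
  (intp p pfin).1 (intp r rfin).1.
have := ge0_integral_diff_le pbra measurableT mfn (fun x => funeneg_ge0 _ x)
  (intn p pfin).1 (intn r rfin).1.
have intE (m : {measure set S -> \bar R}) : \int[m]_x (f x)%:E =
    \int[m]_x (EFin \o f)^\+ x - \int[m]_x (EFin \o f)^\- x.
  exact: (integralE m setT (EFin \o f)).
rewrite (intE p) (intE r).
have [_ [p1 ->]] := intp p pfin; have [_ [r1 ->]] := intp r rfin.
have [_ [a1 ->]] := intp a afin; have [_ [b1 ->]] := intp b bfin.
have [_ [p2 ->]] := intn p pfin; have [_ [r2 ->]] := intn r rfin.
have [_ [a2 ->]] := intn a afin; have [_ [b2 ->]] := intn b bfin.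
rewrite -!EFinB -!EFinD !abse_EFin !lee_fin !ler_norml => /andP[? ?] /andP[? ?].
by apply/andP; split; lra.
Qed.

End total_variation.

Lemma tv_dist_ge0 d (S : measurableType d) (R : realType)
    (p r : {measure set S -> \bar R}) : 0 <= tv_dist p r.
Proof.
apply: le_ereal_sup_tmp; exists 0 => //; exists (cst 0%R).
  by split => // x; rewrite normr0 ler01.
by rewrite !integral0_eq// sube0 abse0.
Qed.

Lemma tv_dist_ext d (Z : measurableType d) (R : realType)
    (p p' r : {measure set Z -> \bar R}) :
  (forall A, measurable A -> p A = p' A) -> tv_dist p r = tv_dist p' r.
Proof.
move=> pp'; rewrite /tv_dist; congr ereal_sup; apply: eq_imagel => f _.
by congr (`|_ - _|); apply: eq_measure_integral => A mA _; exact: pp'.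
Qed.

(** * Contraction by a kernel *)

Section dobrushin_bounds.
Context d1 d2 (S1 : measurableType d1) (S2 : measurableType d2) (R : realType).
Variable K : R.-pker S1 ~> S2.

Lemma dobrushin_ge0 : 0 <= dobrushin K.
Proof.
apply: le_ereal_inf_tmp => _ [x [x' [m [A [_ _ _ ->]]]]].
by apply: sume_ge0 => i _; rewrite le_min !measure_ge0.
Qed.

(** The value of the partition into A and its complement, where each minimum is
    bounded by one of its two entries. *)
Lemma dobrushin_le_set x x' A : measurable A ->
  dobrushin K <= K x' A + K x (~` A).
Proof.
move=> mA; pose F (i : 'I_2) := if i == ord0 then A else ~` A.
apply: (@le_trans _ _ (\sum_(i < 2) Order.min (K x (F i)) (K x' (F i)))).
  apply: ereal_inf_lbound; exists x, x', 2%N, F; split => //.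
  - by move=> i; rewrite /F; case: ifP => // _; exact: measurableC.
  - move=> i j _ _; rewrite /F; case: i => [[|[|//]]] ?; case: j => [[|[|//]]] ? /= [y [Fi Fj]]//;
    exact: val_inj.
  - apply/seteqP; split => // y _; have [Ay|Ay] := pselect (A y).
      by exists ord0.
    by exists ord_max.
rewrite !big_ord_recl big_ord0 adde0 /F /=.
by apply: leeD; rewrite ge_min lexx ?orbT.
Qed.

Lemma dobrushin_le1 (x : S1) : dobrushin K <= 1.
Proof.
by have := dobrushin_le_set x x measurableT; rewrite setCT measure0 adde0 prob_kernel.
Qed.

Lemma dobrushin_fin_num (x : S1) : dobrushin K \is a fin_num.
Proof.
rewrite ge0_fin_numE; last exact: dobrushin_ge0.
exact: le_lt_trans (dobrushin_le1 x) (ltry _).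
Qed.

Lemma one_sub_dobrushin_ge0 (x : S1) : 0 <= 1 - dobrushin K.
Proof. by rewrite suber_ge0 ?dobrushin_fin_num ?dobrushin_le1. Qed.

Lemma two_sub_dobrushin_ge0 (x : S1) : 0 <= 2%:E - dobrushin K.
Proof.
rewrite suber_ge0 ?dobrushin_fin_num//; apply: le_trans (dobrushin_le1 x) _.
by rewrite lee_fin ler1n.
Qed.

Lemma kernel_fin_num x A : measurable A -> K x A \is a fin_num.
Proof. by move=> mA; apply: fin_num_measure_lty => //; rewrite prob_kernel ltry. Qed.

Lemma kernel_osc x x' A : measurable A ->
  K x A - K x' A <= 1 - dobrushin K.
Proof.
(* 1 - K x A is the mass of the complement of A under K x *)
move=> mA; have := dobrushin_le_set x x' mA.
have : K x A + K x (~` A) = 1.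
  rewrite -(prob_kernel (s:=K) x) -(setUv A) measureU//; [exact: measurableC|exact: setICr].
have := dobrushin_fin_num x.
have := kernel_fin_num x mA; have := kernel_fin_num x' mA.
have := kernel_fin_num x (measurableC mA).
case: (K x (~` A)) (K x' A) (K x A) (dobrushin K) => [q| |] [p| |] [r| |] [s| |]// _ _ _ _.
by rewrite -EFinD => -[?]; rewrite -!EFinB -EFinD !lee_fin; lra.
Qed.

End dobrushin_bounds.

Section contraction.
Context d (S : measurableType d) (R : realType).
Implicit Types (p r : {measure set S -> \bar R}).

(** The Jordan parts a and b have equal mass, half of the distance.  After phi is
    replaced by phi - inf phi, which lies between 0 and c and has the same
    difference of integrals, the part b contributes negatively and the part a at
    most c times its mass. *)
Lemma integral_diff_le_osc p r (phi : S -> R) (c : R) :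
  p [set: S] = 1 -> r [set: S] = 1 ->
  measurable_fun [set: S] phi -> (forall x, 0 <= phi x)%R ->
  (forall x x', phi x - phi x' <= c)%R ->
  2%:E * (\int[p]_x (phi x)%:E - \int[r]_x (phi x)%:E) <= c%:E * tv_dist p r.
Proof.
move=> p1 r1 mphi phi0 phic.
have [x0 _] := measure1_nonempty p1.
have pfin : p [set: S] < +oo by rewrite p1 ltry.
have rfin : r [set: S] < +oo by rewrite r1 ltry.
have [P [a [b [mP afin bfin pbra [tvE _]]]]] := tv_distE pfin rfin.
have ab : a [set: S] = b [set: S].
  have := pbra _ measurableT; rewrite p1 r1.
  move: (measure_ge0 a setT) (measure_ge0 b setT) afin bfin.
  case: (a setT) (b setT) => [a'| |] [b'| |]// _ _ _ _ [?]; congr EFin; lra.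
pose i := inf (range phi).
have lbphi : has_inf (range phi).
  by split; [exists (phi x0), x0|exists 0%R => _ [x _ <-]].
have i0 : (0 <= i)%R by apply: lb_le_inf => [|_ [x _ <-]]; [exact: lbphi.1|].
have iphi x : (i <= phi x)%R by apply: ge_inf; [exact: lbphi.2|exists x].
have phiic x : (phi x - i <= c)%R.
  rewrite lerBlDl -lerBlDr; apply: lb_le_inf; first exact: lbphi.1.
  by move=> _ [x' _ <-]; have := phic x x'; lra.
pose f x := (phi x - i)%:E.
have f0 x : 0 <= f x by rewrite lee_fin subr_ge0.
have mf : measurable_fun [set: S] f by apply/measurable_EFinP/measurable_funB.
have fc (m : {measure set S -> \bar R}) : \int[m]_x f x <= c%:E * m [set: S].
  rewrite -integral_cst//; apply: ge0_le_integral => // x _.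
  by rewrite /= lee_fin.
have phiE (m : {measure set S -> \bar R}) : m [set: S] = 1 ->
    \int[m]_x (phi x)%:E = \int[m]_x f x + i%:E.
  move=> m1; transitivity (\int[m]_x (f x + cst i%:E x)).
    by apply: eq_integral => x _; rewrite /f /= -EFinD subrK.
  by rewrite ge0_integralD// integral_cst// m1 mule1.
rewrite (phiE _ p1) (phiE _ r1).
have := ge0_integral_add_eq pbra measurableT mf f0.
have fE (m : {measure set S -> \bar R}) (t : R) : m [set: S] = t%:E ->
    exists v, [/\ \int[m]_x f x = v%:E, (0 <= v)%R & (v <= c * t)%R].
  move=> mt; have := fc m; have : 0 <= \int[m]_x f x by apply: integral_ge0 => x _.
  rewrite mt -EFinM; case: (\int[m]_x f x) => [v| |]//.
  by rewrite !lee_fin => ? ?; exists v.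
have [u [-> u0 uc]] := fE _ _ p1; have [v [-> v0 vc]] := fE _ _ r1.
have aE : a [set: S] = (fine (a [set: S]))%:E by rewrite fineK// ge0_fin_numE.
have [a' [-> a0 ac]] := fE _ _ aE; have [b' [-> b0 bc]] := fE _ _ (etrans (esym ab) aE).
rewrite tvE -ab aE -!EFinD => -[e]; rewrite -!EFinM lee_fin; lra.
Qed.

End contraction.

Section kernel_contraction.
Context d1 d2 (S1 : measurableType d1) (S2 : measurableType d2) (R : realType).
Implicit Types (p r : {measure set S1 -> \bar R}).

(** [integral_diff_le_osc] for K x A as a function of x, whose oscillation is
    bounded by [kernel_osc]. *)
Lemma kernel_integral_diff_le (K : R.-pker S1 ~> S2) p r (A : set S2) :
  p [set: S1] = 1 -> r [set: S1] = 1 -> measurable A ->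
  2%:E * (\int[p]_x K x A - \int[r]_x K x A) <=
  (1 - dobrushin K) * tv_dist p r.
Proof.
move=> p1 r1 mA.
have [x0 _] := measure1_nonempty p1.
have KE x : K x A = (fine (K x A))%:E by rewrite fineK// kernel_fin_num.
have cE : 1 - dobrushin K = (fine (1 - dobrushin K))%:E.
  by rewrite fineK// fin_numB dobrushin_fin_num.
under eq_integral do rewrite KE.
under [X in _ - X]eq_integral do rewrite KE.
rewrite cE; apply: (integral_diff_le_osc (phi := fun x => fine (K x A))) => //.
- by apply: measurableT_comp => //; exact: measurable_kernel.
- by move=> x x'; rewrite -lee_fin EFinB -cE -!KE kernel_osc.
Qed.

End kernel_contraction.

Section predict_contraction.
Context d (S : measurableType d) (R : realType) (T : R.-pker S ~> S).
Implicit Types (p r : {measure set S -> \bar R}).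

Lemma predict_setT p : predict T p [set: S] = p [set: S].
Proof.
rewrite /= /predict; under eq_integral do rewrite prob_kernel.
by rewrite integral_cst// mul1e.
Qed.

(** For measures of equal mass the two terms of [tv_distE] agree, so the distance
    is twice the difference on the Hahn set. *)
Lemma tv_dist_predict p r : p [set: S] = 1 -> r [set: S] = 1 ->
  tv_dist (predict T p) (predict T r) <= (1 - dobrushin T) * tv_dist p r.
Proof.
move=> p1 r1.
have Tp1 : predict T p [set: S] = 1 by rewrite predict_setT.
have Tr1 : predict T r [set: S] = 1 by rewrite predict_setT.
have Tpfin : predict T p [set: S] < +oo by rewrite Tp1 ltry.
have Trfin : predict T r [set: S] < +oo by rewrite Tr1 ltry.
have [P [_ [_ [mP _ _ _ [_ ->]]]]] := tv_distE Tpfin Trfin.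
apply: le_trans (kernel_integral_diff_le T p1 r1 mP).
have mC := measurableC mP.
have split1 (q : {measure set S -> \bar R}) : q [set: S] = 1 -> q P + q (~` P) = 1.
  by move=> <-; rewrite -(setUv P) measureU// setICr.
rewrite -!/(predict T _ _); move: (split1 _ Tp1) (split1 _ Tr1).
have := fin_num_measure_lty Tpfin mP; have := fin_num_measure_lty Trfin mP.
have := fin_num_measure_lty Tpfin mC; have := fin_num_measure_lty Trfin mC.
rewrite /=.
case: (predict T p P) (predict T r P) (predict T p (~` P)) (predict T r (~` P))
  => [u| |] [v| |] [u'| |] [v'| |]// _ _ _ _ [?] [?].
rewrite -!EFinB -EFinD lee_fin; lra.
Qed.

End predict_contraction.

(** * Contraction of the Bayes update *)

Section likelihood_lemmas.
Context dX dY (X : measurableType dX) (Y : measurableType dY) (R : realType).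
Variables (Q : R.-pker X ~> Y) (lam : probability Y R) (g : likelihood Q lam).
Implicit Types (p r : {measure set X -> \bar R}).

(** The density with respect to lam of the law of the observation when the state
    has law p. *)
Definition evidence p (y : Y) : \bar R := \int[p]_x (g x y)%:E.

Lemma evidence_ge0 p y : 0 <= evidence p y.
Proof. by apply: integral_ge0 => x _; rewrite lee_fin lik_ge0. Qed.

Lemma measurable_lik_pair : measurable_fun [set: X * Y] (fun xy => (g xy.1 xy.2)%:E).
Proof. by apply/measurable_EFinP; exact: measurable_lik. Qed.

Lemma measurable_lik1 y : measurable_fun [set: X] (fun x => (g x y)%:E).
Proof. exact: measurable_fun_pair1 measurable_lik_pair. Qed.

Lemma measurable_lik2 x : measurable_fun [set: Y] (g x).
Proof. by apply: measurable_fun_pair2 (measurable_lik g). Qed.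

Lemma integral_lik x (h : Y -> \bar R) : (forall y, 0 <= h y) ->
  measurable_fun [set: Y] h ->
  \int[Q x]_y h y = \int[lam]_y (h y * (g x y)%:E).
Proof.
by move=> h0 mh; apply: integral_density => //; [exact: lik_ge0|
  exact: measurable_lik2|exact: lik_density].
Qed.

(** Tonelli, with g x the density of Q x. *)
Lemma integral_evidence p (h : Y -> \bar R) : p [set: X] < +oo ->
  (forall y, 0 <= h y) -> measurable_fun [set: Y] h ->
  \int[lam]_y (h y * evidence p y) = \int[p]_x \int[Q x]_y h y.
Proof.
move=> pfin h0 mh; under [RHS]eq_integral do rewrite integral_lik//.
have pE f : \int[p]_x f x = \int[finite_copy pfin]_x f x.
  exact: eq_measure_integral.
pose F (xy : X * Y) := h xy.2 * (g xy.1 xy.2)%:E.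
have mF : measurable_fun [set: X * Y] F.
  by apply: emeasurable_funM; [exact: measurableT_comp|exact: measurable_lik_pair].
have F0 xy : 0 <= F xy by rewrite mule_ge0// lee_fin lik_ge0.
rewrite pE (fubini_tonelli F mF F0).
apply: eq_integral => y _; rewrite -pE /F /= ge0_integralZl//.
- exact: measurable_lik1.
- by move=> x _; rewrite lee_fin lik_ge0.
Qed.

(** Also true when the evidence vanishes: then both sides are 0. *)
Lemma bayes_mul_evidence p y A : evidence p y < +oo -> measurable A ->
  bayes g p y A * evidence p y = \int[p]_(x in A) (g x y)%:E.
Proof.
move=> Ny mA; rewrite /= /bayes -/(evidence p y).
have UN : \int[p]_(x in A) (g x y)%:E <= evidence p y.
  apply: ge0_subset_integral => //; first exact: measurable_lik1.
  by move=> x _; rewrite lee_fin lik_ge0.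
have U0 : 0 <= \int[p]_(x in A) (g x y)%:E.
  by apply: integral_ge0 => x _; rewrite lee_fin lik_ge0.
case: ifPn => [N0|]; last first.
  rewrite -leNgt => N0; rewrite mul0e; apply/eqP; rewrite eq_le U0 /=.
  exact: le_trans UN N0.
have NE : evidence p y = (fine (evidence p y))%:E by rewrite fineK// ge0_fin_numE// ltW.
rewrite NE inver gt_eqF ?fine_gt0 ?N0//.
by rewrite -muleA -EFinM mulVf ?mule1// gt_eqF// fine_gt0// N0.
Qed.

Lemma bayes_setT p y : 0 < evidence p y < +oo -> bayes g p y [set: X] = 1.
Proof.
move=> /andP[N0 Ny]; rewrite /= /bayes -/(evidence p y) N0.
have NE : evidence p y = (fine (evidence p y))%:E by rewrite fineK// ge0_fin_numE// ltW.
by rewrite NE inver gt_eqF ?fine_gt0 ?N0// -EFinM mulfV// gt_eqF// fine_gt0// N0.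
Qed.

Lemma bayes_le1 p y : bayes g p y [set: X] <= 1.
Proof.
have [N0|N0] := ltP 0 (evidence p y); last first.
  by rewrite /= /bayes -/(evidence p y) ltNge N0 /= lee01.
have [Ny|] := ltP (evidence p y) +oo; first by rewrite bayes_setT ?N0.
by rewrite leye_eq => /eqP Ny; rewrite /= /bayes -/(evidence p y) Ny invey mule0; case: ifP.
Qed.

(** Multiplied by the evidence of p, the difference of the two posteriors on A is
    the difference of the unnormalized posteriors plus the posterior of r on A
    times the difference of the evidences.  On the Hahn set and on its complement
    the first terms are bounded by the Jordan parts, and the two posterior masses
    of r differ by at most 1. *)
Lemma tv_dist_bayes_le p r y (a b : {measure set X -> \bar R}) :
  (forall A, measurable A -> p A + b A = r A + a A) ->
  evidence p y < +oo -> evidence r y < +oo ->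
  tv_dist (bayes g p y) (bayes g r y) * evidence p y <=
  (evidence a y + evidence b y) + `|evidence p y - evidence r y|.
Proof.
move=> pbra py ry.
pose B (q : {measure set X -> \bar R}) : {measure set X -> \bar R} := bayes g q y.
have bfin (q : {measure set X -> \bar R}) : B q [set: X] < +oo.
  exact: le_lt_trans (bayes_le1 q y) (ltry _).
have [P [_ [_ [mP _ _ _ [_ ->]]]]] := tv_distE (bfin p) (bfin r).
have mC := measurableC mP.
have ml := measurable_lik1 y.
have l0 x : 0 <= (g x y)%:E by rewrite lee_fin lik_ge0.
have evs (q : {measure set X -> \bar R}) : evidence q y =
    \int[q]_(x in P) (g x y)%:E + \int[q]_(x in ~` P) (g x y)%:E.
  rewrite -ge0_integral_setU//.
  - by rewrite setUv.
  - by rewrite setUv.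
  - by rewrite disj_set2E setICr.
have subN (q : {measure set X -> \bar R}) A : measurable A ->
    \int[q]_(x in A) (g x y)%:E <= evidence q y.
  by move=> mA; apply: ge0_subset_integral.
have finU (q : {measure set X -> \bar R}) A : evidence q y < +oo -> measurable A ->
    exists v, \int[q]_(x in A) (g x y)%:E = v%:E.
  move=> qy mA; exists (fine (\int[q]_(x in A) (g x y)%:E)); rewrite fineK// ge0_fin_numE.
    exact: le_lt_trans (subN _ _ mA) qy.
  exact: integral_ge0.
have diffP := ge0_integral_diff_le pbra mP ml l0
  (le_lt_trans (subN _ _ mP) py) (le_lt_trans (subN _ _ mP) ry).
have diffC := ge0_integral_diff_le pbra mC ml l0
  (le_lt_trans (subN _ _ mC) py) (le_lt_trans (subN _ _ mC) ry).
apply: (@le_trans _ _ ((\int[a]_(x in P) (g x y)%:E + \int[b]_(x in P) (g x y)%:E) +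
   (\int[a]_(x in ~` P) (g x y)%:E + \int[b]_(x in ~` P) (g x y)%:E) +
   `|evidence p y - evidence r y|)); last first.
  by apply: leeD => //; rewrite (evs a) (evs b) addeACA.
apply: le_trans (leeD (leeD diffP diffC) (lexx _)).
have BE (q : {measure set X -> \bar R}) A : evidence q y < +oo -> measurable A ->
    B q A * evidence q y = \int[q]_(x in A) (g x y)%:E.
  exact: bayes_mul_evidence.
move: (BE _ _ py mP) (BE _ _ py mC) (BE _ _ ry mP) (BE _ _ ry mC).
have psum (q : {measure set X -> \bar R}) : B q P + B q (~` P) <= 1.
  by apply: le_trans (bayes_le1 q y); rewrite -(setUv P) measureU// setICr.
have B0 A : 0 <= B r A by exact: measure_ge0.
move: (psum r) (B0 P) (B0 (~` P)).
have bf (q : {measure set X -> \bar R}) A : measurable A -> exists v, B q A = v%:E.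
  by move=> mA; exists (fine (B q A)); rewrite fineK// (fin_num_measure_lty (bfin q)).
rewrite (evs p) (evs r).
have [pP ->] := finU p P py mP; have [pC ->] := finU p (~` P) py mC.
have [rP ->] := finU r P ry mP; have [rC ->] := finU r (~` P) ry mC.
have [bpP ->] := bf p P mP; have [bpC ->] := bf p (~` P) mC.
have [brP ->] := bf r P mP; have [brC ->] := bf r (~` P) mC.
rewrite -!EFinD -!EFinM !lee_fin => sum1 brP0 brC0 [epP] [epC] [erP] [erC].
rewrite (_ : (_ * _)%R = (pP - rP) - (pC - rC) +
  (brC - brP) * ((pP + pC) - (rP + rC)))%R; last by lra.
have h1 := ler_norm (pP - rP); have h2 := ler_norm (- (pC - rC)).
have h3 := ler_norm ((brC - brP) * (pP + pC - (rP + rC)))%R.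
move: h2 h3; rewrite normrN normrM => h2 h3.
have : (`|brC - brP| * `|pP + pC - (rP + rC)| <= `|pP + pC - (rP + rC)|)%R.
  by rewrite ler_piMl// ler_norml; apply/andP; split; lra.
lra.
Qed.

Lemma integral_evidence_set p (C : set Y) : p [set: X] < +oo -> measurable C ->
  \int[lam]_(y in C) evidence p y = \int[p]_x Q x C.
Proof.
move=> pfin mC; rewrite [LHS]integral_indicE integral_evidence//.
- by apply: eq_integral => x _; rewrite integral_indic// setIT.
- exact: measurable_EFin_indic.
Qed.

Lemma measurable_evidence p : p [set: X] < +oo -> measurable_fun [set: Y] (evidence p).
Proof.
move=> pfin.
rewrite (_ : evidence p = fun y => \int[finite_copy pfin]_x (g x y)%:E); last first.
  by apply/funext => y; exact: eq_measure_integral.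
apply: (measurable_fun_fubini_tonelli_G (fun xy : X * Y => (g xy.1 xy.2)%:E)).
  exact: measurable_lik_pair.
by move=> xy; rewrite lee_fin lik_ge0.
Qed.

Lemma ae_evidence_lty p : p [set: X] < +oo -> {ae lam, forall y, evidence p y < +oo}.
Proof.
move=> pfin; have mN := measurable_evidence pfin.
have : lam.-integrable [set: Y] (evidence p).
  apply/integrableP; split => //.
  under eq_integral do rewrite gee0_abs ?evidence_ge0//.
  rewrite integral_evidence_set//; under eq_integral do rewrite prob_kernel.
  by rewrite integral_cst// mul1e.
move=> /(integrable_ae measurableT); apply: filterS => y /(_ Logic.I).
by rewrite fin_numElt => /andP[].
Qed.

(** On the set C where the evidence of p dominates, the integral is the excess of
    the observation law of p over that of r; off C it is the opposite excess, and
    the two agree since both laws have mass 1.  One application of the kernel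
    contraction to Q and C bounds twice this excess. *)
Lemma integral_dist_evidence_le p r : p [set: X] = 1 -> r [set: X] = 1 ->
  \int[lam]_y `|evidence p y - evidence r y| <= (1 - dobrushin Q) * tv_dist p r.
Proof.
move=> p1 r1.
have pfin : p [set: X] < +oo by rewrite p1 ltry.
have rfin : r [set: X] < +oo by rewrite r1 ltry.
have mp := measurable_evidence pfin; have mr := measurable_evidence rfin.
pose C := [set y | evidence r y <= evidence p y].
have mC : measurable C by rewrite -[C]setTI; exact: measurable_lee.
have mCC := measurableC mC.
have mpr : measurable_fun [set: Y] (fun y => `|evidence p y - evidence r y|).
  by apply: measurableT_comp => //; exact: emeasurable_funB.
(* a sum and not a difference, since the evidences are finite only almost
   everywhere *)
have split_ge (D : set Y) (p' r' : {measure set X -> \bar R}) : measurable D ->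
    p' [set: X] < +oo -> r' [set: X] < +oo ->
    (forall y, D y -> evidence r' y <= evidence p' y) ->
    measurable_fun [set: Y] (fun y => `|evidence p' y - evidence r' y|) ->
    \int[lam]_(y in D) `|evidence p' y - evidence r' y| + \int[r']_x Q x D =
    \int[p']_x Q x D.
  move=> mD p'fin r'fin Dle mpr'.
  have mp' := measurable_evidence p'fin; have mr' := measurable_evidence r'fin.
  rewrite -(integral_evidence_set p'fin mD) -(integral_evidence_set r'fin mD).
  rewrite -ge0_integralD//; first last.
  - exact: measurable_funTS.
  - by move=> y _; exact: evidence_ge0.
  - exact: measurable_funTS.
  apply: ge0_ae_eq_integral => //.
  - by apply: emeasurable_funD; exact: measurable_funTS.
  - exact: measurable_funTS.
  - by move=> y _; rewrite adde_ge0// evidence_ge0.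
  - by move=> y _; exact: evidence_ge0.
  - have := ae_evidence_lty r'fin; apply: filterS => y ry Dy.
    have rf : evidence r' y \is a fin_num by rewrite ge0_fin_numE ?evidence_ge0.
    by rewrite gee0_abs ?subeK// suber_ge0 ?Dle.
have Q1 (q : {measure set X -> \bar R}) : q [set: X] = 1 ->
    exists u v, [/\ \int[q]_x Q x C = u%:E, \int[q]_x Q x (~` C) = v%:E & (u + v = 1)%R].
  move=> q1; have : \int[q]_x Q x C + \int[q]_x Q x (~` C) = 1.
    rewrite -ge0_integralD//; [|exact: measurable_kernel..].
    rewrite (eq_integral (cst 1)); first by rewrite integral_cst// mul1e.
    by move=> x _; rewrite /= -(prob_kernel (s:=Q) x) -(setUv C) measureU// setICr.
  have : 0 <= \int[q]_x Q x C by apply: integral_ge0 => x _.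
  have : 0 <= \int[q]_x Q x (~` C) by apply: integral_ge0 => x _.
  case: (\int[q]_x Q x C) => [u| |]//; case: (\int[q]_x Q x (~` C)) => [v| |]// _ _ [uv].
  by exists u, v.
have := kernel_integral_diff_le Q p1 r1 mC.
have := split_ge C p r mC pfin rfin (fun y Cy => Cy) mpr.
have := split_ge (~` C) r p mCC rfin pfin.
rewrite (_ : (fun y => `|evidence r y - evidence p y|) =
  (fun y => `|evidence p y - evidence r y|)); last first.
  apply/funext => y; case: (evidence r y) (evidence p y) => [u| |] [v| |]//.
  by rewrite -!EFinB !abse_EFin distrC.
have Cle y : (~` C) y -> evidence p y <= evidence r y.
  by rewrite /C /= => /negP; rewrite -ltNge => /ltW.
move=> /(_ Cle mpr).
have dE : \int[lam]_y `|evidence p y - evidence r y| =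
    \int[lam]_(y in C) `|evidence p y - evidence r y| +
    \int[lam]_(y in ~` C) `|evidence p y - evidence r y|.
  by rewrite -ge0_integral_setU// ?setUv// disj_set2E setICr.
have I0 (D : set Y) : 0 <= \int[lam]_(y in D) `|evidence p y - evidence r y|.
  by apply: integral_ge0 => y _.
have [u [v [-> -> uv]]] := Q1 p p1; have [u' [v' [-> -> uv']]] := Q1 r r1.
rewrite dE; move: (I0 C) (I0 (~` C)).
case: (\int[lam]_(y in C) _) => [c| |]//; case: (\int[lam]_(y in ~` C) _) => [c'| |]//.
move=> _ _ [e1] [e2]; apply: le_trans.
rewrite -!EFinD -EFinM lee_fin; lra.
Qed.

(** Each likelihood is a probability density, so the evidences of the Jordan parts
    integrate to their masses, which add up to the distance; the remaining term is
    bounded by [integral_dist_evidence_le]. *)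
Lemma integral_tv_dist_bayes_le p r : p [set: X] = 1 -> r [set: X] = 1 ->
  measurable_fun [set: Y] (fun y => tv_dist (bayes g p y) (bayes g r y)) ->
  \int[lam]_y (tv_dist (bayes g p y) (bayes g r y) * evidence p y) <=
  (2%:E - dobrushin Q) * tv_dist p r.
Proof.
move=> p1 r1 mtv.
have pfin : p [set: X] < +oo by rewrite p1 ltry.
have rfin : r [set: X] < +oo by rewrite r1 ltry.
have [x0 _] := measure1_nonempty p1.
have [_ [a [b [_ afin bfin pbra [tvE _]]]]] := tv_distE pfin rfin.
have mp := measurable_evidence pfin; have mr := measurable_evidence rfin.
have ma := measurable_evidence afin; have mb := measurable_evidence bfin.
have mpr : measurable_fun [set: Y] (fun y => `|evidence p y - evidence r y|).
  by apply: measurableT_comp => //; exact: emeasurable_funB.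
have evT (m : {measure set X -> \bar R}) : m [set: X] < +oo ->
    \int[lam]_y evidence m y = m [set: X].
  move=> mfin; rewrite integral_evidence_set//.
  under eq_integral do rewrite prob_kernel.
  by rewrite integral_cst// mul1e.
apply: (@le_trans _ _ (\int[lam]_y ((evidence a y + evidence b y) +
    `|evidence p y - evidence r y|))).
  apply: ae_ge0_le_integral => //.
  - by move=> y _; rewrite mule_ge0 ?evidence_ge0 ?tv_dist_ge0.
  - exact: emeasurable_funM.
  - by move=> y _; apply: adde_ge0 => //; apply: adde_ge0; exact: evidence_ge0.
  - by apply: emeasurable_funD => //; exact: emeasurable_funD.
  - have := ae_evidence_lty rfin; have := ae_evidence_lty pfin.
    by apply: filterS2 => y py ry _; exact: tv_dist_bayes_le.
rewrite ge0_integralD//; last 2 first.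
  - by move=> y _; apply: adde_ge0; exact: evidence_ge0.
  - exact: emeasurable_funD.
rewrite ge0_integralD//; last 2 first.
  - by move=> y _; exact: evidence_ge0.
  - by move=> y _; exact: evidence_ge0.
rewrite !evT// -tvE.
apply: le_trans (leeD (lexx _) (integral_dist_evidence_le p1 r1)) _.
have := dobrushin_le1 Q x0; have := dobrushin_fin_num Q x0.
case: (dobrushin Q) => [q| |]// _; rewrite lee_fin => q1.
rewrite -[X in X + _]mul1e -ge0_muleDl ?lee_fin ?subr_ge0//.
by rewrite -!EFinB -EFinD (_ : (1 + (1 - q) = 2 - q)%R)//; lra.
Qed.

End likelihood_lemmas.

(** * Total variation on a countably generated sigma-algebra *)

Section tv_sequence.
Context d (S : measurableType d) (R : realType).

(** A sequence of sets that computes the total variation distance of any two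
    finite measures; the terms of the supremum are the lower bounds of
    [tv_dist_ge]. *)
Definition tv_generating (C : nat -> set S) : Prop :=
  (forall k, measurable (C k)) /\
  forall p r : {measure set S -> \bar R},
    p [set: S] < +oo -> r [set: S] < +oo ->
    tv_dist p r = ereal_sup (range (fun k =>
      (p (C k) - r (C k)) + (r (~` C k) - p (~` C k)))).

(** Fix two finite measures.  The sets whose contribution is at most the supremum
    over the algebra form a monotone class by continuity of the measures, so
    they include every measurable set, in particular the Hahn set. *)
Lemma tv_generating_algebra (C : nat -> set S) :
  setring (range C) -> range C [set: S] -> measurable = <<s range C>> ->
  tv_generating C.
Proof.
move=> ringC CT mE.
have mC k : measurable (C k) by rewrite mE; apply: sub_sigma_algebra; exists k.
split => // p r pfin rfin; apply/eqP; rewrite eq_le; apply/andP; split; last first.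
  by apply: ge_ereal_sup => _ [k _ <-]; exact: tv_dist_ge.
pose v A := (p A - r A) + (r (~` A) - p (~` A)).
set s := ereal_sup _.
pose G := [set A | measurable A /\ v A <= s].
have cvgv (F : nat -> set S) A : (forall n, measurable (F n)) -> measurable A ->
    (forall m : {measure set S -> \bar R}, m [set: S] < +oo ->
       m (F n) @[n --> \oo] --> m A /\ m (~` F n) @[n --> \oo] --> m (~` A)) ->
    v (F n) @[n --> \oo] --> v A.
  move=> mF mA cvgF; have mAC := measurableC mA.
  have [pF pFC] := cvgF p pfin; have [rF rFC] := cvgF r rfin.
  have pA := fin_num_measure_lty pfin mA; have rA := fin_num_measure_lty rfin mA.
  have pAC := fin_num_measure_lty pfin mAC; have rAC := fin_num_measure_lty rfin mAC.
  apply: cvgeD; first by rewrite fin_num_adde_defl// fin_numB rAC pAC.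
    by apply: cvgeB => //; rewrite fin_num_adde_defr.
  by apply: cvgeB => //; rewrite fin_num_adde_defr.
have le_lim (F : nat -> set S) A : (forall n, G (F n)) -> v (F n) @[n --> \oo] --> v A ->
    v A <= s.
  by move=> GF; apply: cvge_le; apply: nearW => n; exact: (GF n).2.
have finS (m : {measure set S -> \bar R}) A : m [set: S] < +oo -> measurable A -> m A < +oo.
  by move=> mfin mA; apply: le_lt_trans mfin; apply: le_measure; rewrite ?inE.
have monG : monotone G.
  split=> F ndF GF.
  - have mF n : measurable (F n) by exact: (GF n).1.
    have mU : measurable (\bigcup_n F n) by exact: bigcup_measurable.
    split => //; apply: (le_lim F) => //; apply: cvgv => // m mfin; split.
      exact: nondecreasing_cvg_mu.
    rewrite setC_bigcup; apply: nonincreasing_cvg_mu => //.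
    + by apply: finS => //; exact: measurableC.
    + by move=> n; exact: measurableC.
    + by rewrite -setC_bigcup; exact: measurableC.
    + by move=> a b ab; apply/subsetPset/subsetC/subsetPset/ndF.
  - have mF n : measurable (F n) by exact: (GF n).1.
    have mI : measurable (\bigcap_n F n) by exact: bigcap_measurable.
    split => //; apply: (le_lim F) => //; apply: cvgv => // m mfin; split.
      by apply: nonincreasing_cvg_mu => //; exact: finS.
    rewrite setC_bigcap; apply: nondecreasing_cvg_mu => //.
    + by move=> n; exact: measurableC.
    + by rewrite -setC_bigcap; exact: measurableC.
    + by move=> a b ab; apply/subsetPset/subsetC/subsetPset/ndF.
have CG : range C `<=` G.
  by move=> _ [k _ <-]; split => //; apply: ereal_sup_ubound; exists k.
have sG := monotone_setring_sub_g_sigma_ring monG ringC CG.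
have [P [_ [_ [mP _ _ _ [_ ->]]]]] := tv_distE pfin rfin.
suff : G P by case.
apply: sG; have := mP; rewrite mE; apply: smallest_sub; last exact: sub_g_sigma_ring.
have [s0 sD sU] := @smallest_sigma_ring _ (range C).
split => // A sA; apply: sD => //; exact: sub_g_sigma_ring.
Qed.

End tv_sequence.

(** Equality on the sequence makes the distance vanish, and a vanishing distance
    bounds both the difference on A and its opposite. *)
Lemma eq_measure_tv_generating dX (X : measurableType dX) (R : realType)
    (C : nat -> set X) (p r : {measure set X -> \bar R}) :
  tv_generating R C -> p [set: X] < +oo -> r [set: X] < +oo ->
  (forall k, p (C k) = r (C k)) -> (forall k, p (~` C k) = r (~` C k)) ->
  p [set: X] = r [set: X] ->
  forall A, measurable A -> p A = r A.
Proof.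
move=> [mC tvC] pfin rfin prC prCC prT A mA; have mAC := measurableC mA.
have tv0 : tv_dist p r <= 0.
  rewrite tvC//; apply: ge_ereal_sup => _ [k _ <-].
  rewrite prC prCC subee ?(fin_num_measure_lty rfin)// add0e subee//.
  by rewrite (fin_num_measure_lty rfin)//; exact: measurableC.
have := le_trans (tv_dist_ge pfin rfin mA) tv0.
have := le_trans (tv_dist_ge pfin rfin mAC) tv0; rewrite setCK.
have split1 (q : {measure set X -> \bar R}) : q [set: X] = q A + q (~` A).
  by rewrite -measureU ?setUv// setICr.
move: prT; rewrite (split1 p) (split1 r).
have := fin_num_measure_lty pfin mA; have := fin_num_measure_lty rfin mA.
have := fin_num_measure_lty pfin mAC; have := fin_num_measure_lty rfin mAC.
case: (p A) (r A) (p (~` A)) (r (~` A)) => [a| |] [b| |] [c| |] [e| |]// _ _ _ _ [?].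
by rewrite -!EFinB -!EFinD !lee_fin => ? ?; congr EFin; lra.
Qed.

Section generated_algebra.
Variables (S : Type) (B : nat -> set S).

Definition bits (n : nat) (x : S) : seq bool := mkseq (fun i => `[< B i x >]) n.

(** Each set of the algebra generated by B depends on finitely many of the bits.
    A finite list of admissible bit strings of a given length encodes it, which
    makes countability of the algebra immediate. *)
Definition gen_algebra (k : nat) : set S :=
  if unpickle k is Some (n, s) then [set x | bits n x \in (s : seq (seq bool))]
  else set0.

Lemma take_bits n m x : (n <= m)%N -> take n (bits m x) = bits n x.
Proof. by move=> nm; rewrite /bits /mkseq -map_take take_iota (minn_idPl nm). Qed.

(** A predicate on bit strings of length n is encoded by the list of those that
    satisfy it; with this form the ring operations become boolean operations. *)
Lemma gen_algebraP A :
  range gen_algebra A <-> exists n (P : pred (seq bool)), A = [set x | P (bits n x)].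
Proof.
split=> [[k _ <-]|[n [P ->]]].
  rewrite /gen_algebra; case: unpickle => [[n s]|].
    by exists n, (mem s).
  by exists 0%N, pred0; apply/seteqP; split.
pose s : seq (seq bool) := [seq val t | t <- enum {: n.-tuple bool} & P (val t)].
exists (pickle (n, s)) => //; rewrite /gen_algebra pickleK.
apply/seteqP; split => x /=.
  by move=> /mapP[t]; rewrite mem_filter => /andP[Pt _] ->.
move=> Px; have sz : size (bits n x) == n by rewrite size_mkseq.
apply/mapP; exists (Tuple sz) => //.
by rewrite mem_filter /= Px mem_enum.
Qed.

Lemma setring_gen_algebra : setring (range gen_algebra).
Proof.
split.
- by apply/gen_algebraP; exists 0%N, pred0; apply/seteqP; split.
- move=> _ _ /gen_algebraP[n [P ->]] /gen_algebraP[m [Q ->]]; apply/gen_algebraP.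
  exists (maxn n m), (fun s => P (take n s) || Q (take m s)).
  apply/seteqP; split => x /=; rewrite !take_bits ?leq_maxl ?leq_maxr//.
    by case=> ->; rewrite ?orbT.
  by move=> /orP[]; [left|right].
- move=> _ _ /gen_algebraP[n [P ->]] /gen_algebraP[m [Q ->]]; apply/gen_algebraP.
  exists (maxn n m), (fun s => P (take n s) && ~~ Q (take m s)).
  apply/seteqP; split => x /=; rewrite !take_bits ?leq_maxl ?leq_maxr//.
    by case=> -> /negP.
  by move=> /andP[? /negP].
Qed.

Lemma gen_algebraT : range gen_algebra [set: S].
Proof. by apply/gen_algebraP; exists 0%N, predT; apply/seteqP; split. Qed.

Lemma gen_algebra_sub k : range gen_algebra (B k).
Proof.
apply/gen_algebraP; exists k.+1, (nth false ^~ k).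
by apply/seteqP; split => x /=; rewrite nth_mkseq//; move/asboolP.
Qed.

End generated_algebra.

Lemma measurable_gen_algebra d (S : measurableType d) (B : nat -> set S) :
  (forall k, measurable (B k)) -> range (gen_algebra B) `<=` measurable.
Proof.
move=> mB A /gen_algebraP[n [P ->]].
elim: n P => [|n ih] P.
  have [Pn|Pn] := boolP (P [::]).
    by rewrite (_ : [set _ | _] = setT)//; apply/seteqP; split.
  by rewrite (_ : [set _ | _] = set0)//; apply/seteqP; split => // x; move: Pn => /= /negP.
rewrite (_ : [set _ | _] = (B n `&` [set x | P (rcons (bits B n x) true)]) `|`
   (~` B n `&` [set x | P (rcons (bits B n x) false)])).
  apply: measurableU; apply: measurableI => //.
  - exact: (ih (fun s => P (rcons s true))).
  - exact: measurableC.
  - exact: (ih (fun s => P (rcons s false))).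
apply/seteqP; split => x /=; rewrite /bits mkseqS -/(bits B n x).
  by case: asboolP => Bx Px; [left|right].
by case=> -[Bx]; case: asboolP.
Qed.

Lemma countably_generated_tv d (S : measurableType d) (R : realType) (B : nat -> set S) :
  measurable = <<s range B>> -> exists C : nat -> set S, tv_generating R C.
Proof.
move=> mE; have mB k : measurable (B k).
  by rewrite mE; apply: sub_sigma_algebra; exists k.
exists (gen_algebra B); apply: tv_generating_algebra.
- exact: setring_gen_algebra.
- exact: gen_algebraT.
- apply/seteqP; split.
  + rewrite mE; apply: smallest_sub; first exact: smallest_sigma_algebra.
    by move=> _ [k _ <-]; apply: sub_sigma_algebra; exact: gen_algebra_sub.
  + apply: smallest_sub; first exact: sigma_algebra_measurable.
    exact: measurable_gen_algebra.
Qed.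

(** The balls of radius 1/(j+1) around a dense sequence: each open set is the
    union of those it contains. *)
Lemma polish_countably_generated (R : realType) (X : ptopologicalType) :
  polish R X -> exists B : nat -> set (borel X), measurable = <<s range B>>.
Proof.
move=> [[D [cD dD]] [dist [d0 dC dtri dnbhs _]]].
have [f] := pcard_geP cD.
have oball c e : open [set y | (dist c y < e)%R].
  rewrite openE => x /= cx; apply/dnbhs.
  exists (e - dist c x)%R; first by rewrite subr_gt0.
  by move=> y /= xy; have := dtri c x y; lra.
pose ball k : set X := if unpickle k is Some (i, j)
  then [set y | (dist (f i) y < (j.+1%:R)^-1)%R] else set0.
have open_ball k : open (ball k).
  by rewrite /ball; case: unpickle => [[i j]|]; [exact: oball|exact: open0].
exists ball; apply/seteqP; split; apply: smallest_sub; try exact: smallest_sigma_algebra.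
- move=> O oO.
  have -> : O = \bigcup_(k in [set k | ball k `<=` O]) ball k.
    apply/seteqP; split => [x Ox|x [k kO]]; last exact: kO.
    have : nbhs x O by apply: open_nbhs_nbhs.
    move=> /dnbhs[e e0 eO].
    (* 1/(j+1) < e/2: a point of the dense sequence this close to x has its ball
       inside the ball of radius e around x *)
    pose j := Num.truncn (2 / e)%R.
    have je : ((j.+1%:R)^-1 < e / 2)%R.
      rewrite invf_plt ?posrE ?divr_gt0// invf_div.
      exact: truncnS_gt.
    have j0 : (0 < (j.+1%:R)^-1 :> R)%R by rewrite invr_gt0.
    have xx : (dist x x < (j.+1%:R)^-1)%R by rewrite (d0 x x).2.
    have [y [/= xy Dy]] := dD _ (ex_intro _ x xx) (oball _ _).
    have [i _ fi] := @surj _ _ _ _ f y Dy.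
    exists (pickle (i, j)); rewrite /ball /= pickleK fi /=; last by rewrite dC.
    move=> z /= yz; apply: eO => /=.
    move: je xy yz (dtri x y z); move: (j.+1%:R^-1)%R => t je xy yz xz; lra.
  have [s0 _ sU] := @smallest_sigma_algebra _ [set: X] (range ball).
  rewrite bigcup_mkcond; apply: sU => k; case: ifP => _ //.
  by apply: sub_sigma_algebra; exists k.
- by move=> _ [k _ <-]; apply: sub_sigma_algebra; exact: open_ball.
Qed.

(** * Measurability in a parameter *)

Section sub_kernel.
Context dS dX (S : measurableType dS) (X : measurableType dX) (R : realType).

(** [filter_rec] produces plain measures by recursion, so being a kernel is a
    property to be proved of it and not a structure it comes with.  The mass may
    drop to 0 where a normalization fails. *)
Definition sub_kernel (m : S -> {measure set X -> \bar R}) : Prop :=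
  (forall A, measurable A -> measurable_fun [set: S] (m ^~ A)) /\
  (forall s, m s [set: X] <= 1).

Variables (m : S -> {measure set X -> \bar R}) (km : sub_kernel m).

Lemma sub_kernel_fin s : m s [set: X] < +oo.
Proof. exact: le_lt_trans (km.2 s) (ltry _). Qed.

(** A synonym of m with the kernel structure, which the measurability of integrals
    depending on a parameter is stated for. *)
Definition kernel_copy (_ : sub_kernel m) : S -> {measure set X -> \bar R} := m.

Let kernel_copy_uub : measure_fam_uub (kernel_copy km).
Proof.
by exists 2%R => s; apply: le_lt_trans (km.2 s) _; rewrite lte_fin ltr1n.
Qed.

HB.instance Definition _ := isKernel.Build _ _ _ _ _ (kernel_copy km) km.1.

HB.instance Definition _ := Kernel_isFinite.Build _ _ _ _ _ (kernel_copy km)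
  kernel_copy_uub.

Lemma measurable_sub_kernel_integral (f : S * X -> \bar R) :
  (forall sx, 0 <= f sx) -> measurable_fun [set: S * X] f ->
  measurable_fun [set: S] (fun s => \int[m s]_x f (s, x)).
Proof. exact: (measurable_fun_integral_finite_kernel f (kernel_copy km)). Qed.

End sub_kernel.

Section sub_kernel_operations.
Context dS dX (S : measurableType dS) (X : measurableType dX) (R : realType).
Implicit Types (m : S -> {measure set X -> \bar R}).

Lemma sub_kernel_comp dU (U : measurableType dU) (f : U -> S) m :
  measurable_fun [set: U] f -> sub_kernel m -> sub_kernel (m \o f).
Proof.
move=> mf [mm m1]; split => [A mA|u]; last exact: m1.
by apply: (measurableT_comp (f := m ^~ A)) => //; exact: mm.
Qed.

Lemma sub_kernel_pker (k : R.-pker S ~> X) : sub_kernel k.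
Proof. by split => [A mA|s]; [exact: measurable_kernel|rewrite prob_kernel]. Qed.

Lemma sub_kernel_cst (mu : {measure set X -> \bar R}) : mu [set: X] <= 1 ->
  sub_kernel (fun _ : S => mu).
Proof. by move=> mu1; split => // A _; exact: measurable_cst. Qed.

Lemma sub_kernel_predict (T : R.-pker X ~> X) m : sub_kernel m ->
  sub_kernel (fun s => predict T (m s)).
Proof.
move=> [mm m1]; split => [A mA|s].
  by apply: measurable_fun_integral_kernel => //; exact: measurable_kernel.
by have := m1 s; rewrite -(predict_setT T).
Qed.

Lemma measurable_lik_triple dY (Y : measurableType dY) (Q : R.-pker X ~> Y)
    (lam : probability Y R) (g : likelihood Q lam) :
  measurable_fun [set: S * Y * X] (fun syx => (g syx.2 syx.1.2)%:E).
Proof.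
have mg : measurable_fun [set: S * Y * X] (fun syx => (syx.2, syx.1.2)).
  apply/measurable_fun_pairP; split.
    by rewrite [X in measurable_fun _ X](_ : _ = snd).
  rewrite [X in measurable_fun _ X](_ : _ = snd \o fst)//.
  exact: measurableT_comp.
exact: (measurableT_comp (measurable_lik_pair g) mg).
Qed.

Lemma sub_kernel_evidence dY (Y : measurableType dY) (Q : R.-pker X ~> Y)
    (lam : probability Y R) (g : likelihood Q lam) m : sub_kernel m ->
  measurable_fun [set: S * Y] (fun sy => evidence g (m sy.1) sy.2).
Proof.
move=> km; have km1 : sub_kernel (m \o (@fst S Y)) by exact: sub_kernel_comp.
apply: (measurable_sub_kernel_integral km1 (f := fun syx => (g syx.2 syx.1.2)%:E)).
  by move=> ?; rewrite lee_fin lik_ge0.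
exact: measurable_lik_triple.
Qed.

Lemma sub_kernel_bayes dY (Y : measurableType dY) (Q : R.-pker X ~> Y)
    (lam : probability Y R) (g : likelihood Q lam) m : sub_kernel m ->
  sub_kernel (fun sy : S * Y => bayes g (m sy.1) sy.2).
Proof.
move=> km; split => [A mA|sy]; last exact: bayes_le1.
have mN := sub_kernel_evidence g km.
have km1 : sub_kernel (m \o (@fst S Y)) by exact: sub_kernel_comp.
(* the real inverse, as a power, is measurable; it agrees with the extended one
   also at infinite evidence, where both are 0 *)
rewrite [X in measurable_fun _ X](_ : _ = fun sy : S * Y =>
  if 0 < evidence g (m sy.1) sy.2 then
    (\int[m sy.1]_x ((\1_A x)%:E * (g x sy.2)%:E)) *
    (fine (evidence g (m sy.1) sy.2) `^ (-1))%:E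
  else 0); last first.
  apply/funext => sy; rewrite /= /bayes -/(evidence g (m sy.1) sy.2).
  case: ifP => // N0; congr (_ * _); first exact: integral_indicE.
  rewrite powR_inv1 ?fine_ge0 ?evidence_ge0//.
  case: (evidence g (m sy.1) sy.2) N0 => [v| |]//=; last by rewrite invr0 invey.
  by rewrite lte_fin => v0; rewrite inver gt_eqF.
apply: measurable_fun_ifT => //; first exact: measurable_fun_lte.
apply: emeasurable_funM; last first.
  apply/measurable_EFinP; apply: (measurableT_comp (measurable_powR _)).
  exact: measurableT_comp.
apply: (measurable_sub_kernel_integral km1
  (f := fun syx => (\1_A syx.2)%:E * (g syx.2 syx.1.2)%:E)).
  by move=> ?; rewrite mule_ge0// lee_fin ?lik_ge0.
apply: emeasurable_funM; last exact: measurable_lik_triple.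
by apply/measurable_EFinP; apply: measurableT_comp => //; exact: measurable_indic.
Qed.

(** The sequence turns the distance into a countable supremum of measurable
    functions. *)
Lemma measurable_tv_dist (C : nat -> set X) m1 m2 : tv_generating R C ->
  sub_kernel m1 -> sub_kernel m2 ->
  measurable_fun [set: S] (fun s => tv_dist (m1 s) (m2 s)).
Proof.
move=> [mC tvC] k1 k2.
pose f k s := (m1 s (C k) - m2 s (C k)) + (m2 s (~` C k) - m1 s (~` C k)).
rewrite (_ : (fun s => _) = (fun s => esups (f ^~ s) 0%N)).
  apply: measurable_fun_esups => k; have mCk := measurableC (mC k).
  apply: emeasurable_funD; apply: emeasurable_funB;
    by [exact: k1.1|exact: k2.1].
apply/funext => s; rewrite tvC ?(sub_kernel_fin k1) ?(sub_kernel_fin k2)//.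
congr ereal_sup; apply/seteqP; split => _ [k _ <-]; exists k => //.
Qed.

End sub_kernel_operations.

(** * Disintegration and the Bayes step *)

Section conditional_law_integral.
Context d dS dW (Omega : measurableType d) (S : measurableType dS)
  (W : measurableType dW) (R : realType).
Variables (P : probability Omega R) (H : Omega -> S) (Z : Omega -> W).
Hypotheses (mH : measurable_fun [set: Omega] H) (mZ : measurable_fun [set: Omega] Z).
Variable k : S -> {measure set W -> \bar R}.
Hypotheses (km : sub_kernel k) (cl : cond_law P Z H (fun s => k s)).

(** The law of (H, Z) and the mixture over w of the laws of (H w, z), with z drawn
    from k (H w), agree on rectangles by definition of a conditional law. *)
Lemma cond_law_integral (h : S * W -> \bar R) : (forall sz, 0 <= h sz) ->
  measurable_fun [set: S * W] h ->
  \int[P]_w h (H w, Z w) = \int[P]_w \int[k (H w)]_z h (H w, z).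
Proof.
move=> h0 mh.
have mHZ : measurable_fun [set: Omega] (fun w => (H w, Z w)).
  by apply/measurable_fun_pairP; split.
pose m1 := image_measure P mHZ.
pose kap w := image_measure (k (H w)) (pair1_measurable (H w)).
have kapE w E : measurable E -> kap w E = \int[k (H w)]_z (\1_E (H w, z))%:E.
  move=> mE; rewrite /kap image_measureE//.
  rewrite -[in LHS](setIT (_ @^-1` _)) -integral_indic//.
  by rewrite -[X in measurable X]setTI; exact: pair1_measurable.
have mkap E : measurable E -> measurable_fun [set: Omega] (kap ^~ E).
  move=> mE; under eq_fun do rewrite kapE//.
  apply: (measurableT_comp (f := fun s => \int[k s]_z (\1_E (s, z))%:E)) mH.
  apply: (measurable_sub_kernel_integral km (f := fun sz => (\1_E sz)%:E)).
    by move=> sz; rewrite lee_fin.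
  exact: measurable_EFin_indic.
transitivity (\int[m1]_z h z); first by rewrite integral_image_measure.
rewrite (@integral_mixture _ _ _ _ _ P kap)//.
  apply: eq_integral => w _; rewrite integral_image_measure//.
apply: (@eq_measure_rectangles _ _ _ _ _ m1 (mixture P mkap)).
  by rewrite /m1 image_measureE// preimage_setT; exact: le_lt_trans (probability_le1 P measurableT) (ltry _).
move=> B C mB mC; rewrite /m1 image_measureE; last exact: measurableX.
rewrite [LHS](cl mC mB) integral_mkcond; apply: eq_integral => w _ /=.
rewrite kapE; last exact: measurableX.
rewrite patchE; case: ifPn => wB.
  rewrite (eq_integral (fun z => (\1_C z)%:E)) ?integral_indic ?setIT// => z _.
  rewrite !indicE; congr (_%:R%:E); rewrite in_setX /=.
  by move: wB; rewrite !inE /= => wB; rewrite mem_set.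
rewrite integral0_eq// => z _; rewrite indicE in_setX /=.
by move: wB; rewrite notin_setE /= => wB; rewrite memNset.
Qed.

End conditional_law_integral.

Section bayes_step.
Context d dS dX dY (Omega : measurableType d) (S : measurableType dS)
  (X : measurableType dX) (Y : measurableType dY) (R : realType).
Variables (Q : R.-pker X ~> Y) (lam : probability Y R) (g : likelihood Q lam).
Variables (P : probability Omega R).
Variables (H : Omega -> S) (x : Omega -> X) (y : Omega -> Y).
Hypotheses (mH : measurable_fun [set: Omega] H)
  (mx : measurable_fun [set: Omega] x) (my : measurable_fun [set: Omega] y).
Variables (p : S -> {measure set X -> \bar R}).
Hypotheses (kp : sub_kernel p) (p1 : forall s, p s [set: X] = 1).
Hypothesis joint : forall B A C, measurable B -> measurable A -> measurable C ->
  P (H @^-1` B `&` (x @^-1` A `&` y @^-1` C)) =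
  \int[P]_(w in H @^-1` B) \int[p (H w)]_(x in A) Q x C.

Let mHy : measurable_fun [set: Omega] (fun w => (H w, y w)).
Proof. by apply/measurable_fun_pairP; split. Qed.

Let pfin s : p s [set: X] < +oo. Proof. exact: sub_kernel_fin kp s. Qed.

(** Given H, the law of y is the mixture of the Q x over p (H w), whose density is
    the evidence. *)
Lemma observation_integral (h : S * Y -> \bar R) : (forall sy, 0 <= h sy) ->
  measurable_fun [set: S * Y] h ->
  \int[P]_w h (H w, y w) =
  \int[P]_w \int[lam]_y (h (H w, y) * evidence g (p (H w)) y).
Proof.
move=> h0 mh.
pose k s : {measure set Y -> \bar R} := mixture (p s) (measurable_kernel Q).
have kk : sub_kernel k.
  split => [A mA|s].
    apply: (measurable_fun_integral_kernel (l := p)) => //; first exact: kp.1.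
    exact: measurable_kernel.
  rewrite /k /= /mixture; under eq_integral do rewrite prob_kernel.
  by rewrite integral_cst// p1 mul1e.
have cl : cond_law P y H (fun s => k s).
  move=> C B mC mB; have := joint mB measurableT mC.
  by rewrite preimage_setT setTI.
rewrite (cond_law_integral mH my kk cl)//; apply: eq_integral => w _.
have mhw : measurable_fun [set: Y] (fun y => h (H w, y)).
  by apply: measurableT_comp.
rewrite (@integral_mixture _ _ _ _ _ (p (H w)) Q)//.
- by rewrite integral_evidence.
- by move=> A mA; exact: measurable_kernel.
Qed.

Let measurable_marginal (h : S * Y -> \bar R) : (forall sy, 0 <= h sy) ->
  measurable_fun [set: S * Y] h ->
  measurable_fun [set: Omega]
    (fun w => \int[lam]_y (h (H w, y) * evidence g (p (H w)) y)).
Proof.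
move=> h0 mh.
apply: (measurableT_comp
  (f := fun s => \int[lam]_y (h (s, y) * evidence g (p s) y))) mH.
apply: (measurable_fun_fubini_tonelli_F
  (fun sy : S * Y => h sy * evidence g (p sy.1) sy.2)).
  by apply: emeasurable_funM => //; exact: sub_kernel_evidence.
by move=> sy; rewrite mule_ge0// evidence_ge0.
Qed.

(** Observations avoid null sets, and also the set where their conditional density
    vanishes. *)
Lemma observation_ae (D : set (S * Y)) : measurable D ->
  {ae P, forall w, {ae lam, forall y, D (H w, y) -> evidence g (p (H w)) y = 0}} ->
  {ae P, forall w, ~ D (H w, y w)}.
Proof.
move=> mD DN; have mD1 := measurable_EFin_indic (R := R) mD.
have mpre : measurable ((fun w => (H w, y w)) @^-1` D).
  by rewrite -[X in measurable X]setTI; exact: mHy.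
have PD : P ((fun w => (H w, y w)) @^-1` D) = 0.
  rewrite -[LHS]/(P (_ @^-1` D)) -(setIT (_ @^-1` D)) -integral_indic//.
  rewrite (observation_integral (h := fun sy => (\1_D sy)%:E))//.
  transitivity (\int[P]_w cst 0 w); last by rewrite integral0.
  apply: ge0_ae_eq_integral => //.
  - by apply: (measurable_marginal (h := fun sy => (\1_D sy)%:E)) => // sy; rewrite lee_fin.
  - by move=> w _; apply: integral_ge0 => z _; rewrite mule_ge0 ?lee_fin ?evidence_ge0.
  - apply: filterS DN => w DNw _.
    transitivity (\int[lam]_y cst 0 y); last by rewrite integral0.
    apply: ge0_ae_eq_integral => //.
    + apply: emeasurable_funM.
        by apply: (measurableT_comp mD1); exact: pair1_measurable.
      exact: measurable_evidence.
    + by move=> z _; rewrite mule_ge0 ?lee_fin ?evidence_ge0.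
    + apply: filterS DNw => z Dz _; rewrite indicE.
      by case: (boolP (_ \in D)) => [/set_mem/Dz ->|_]; rewrite ?mule0 ?mul0e.
exists ((fun w => (H w, y w)) @^-1` D); split => //.
by move=> w /= /contrapT.
Qed.

Variable kk : S * Y -> {measure set X -> \bar R}.
Hypotheses (kkk : sub_kernel kk)
  (post : cond_law P x (fun w => (H w, y w)) (fun sy => kk sy)).

Let law := image_measure P mHy.

Let integral_law (E : set (S * Y)) (f : S * Y -> \bar R) : measurable E ->
  (forall sy, 0 <= f sy) -> measurable_fun [set: S * Y] f ->
  \int[law]_(sy in E) f sy = \int[P]_(w in (fun w => (H w, y w)) @^-1` E) f (H w, y w).
Proof.
move=> mE f0 mf; rewrite integral_indicE integral_image_measure.
- by rewrite [RHS]integral_indicE; apply: eq_integral => w _; rewrite !indicE; congr (_%:R%:E * _); exact/idP/idP.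
- by move=> sy; rewrite mule_ge0// lee_fin.
- by apply: emeasurable_funM => //; exact: measurable_EFin_indic.
Qed.

(** Both sides are densities, with respect to the law of (H, y), of the measure
    that sends E to P ((H, y) in E, x in A).  For the Bayes update this is checked
    on rectangles, where the normalization cancels against the density of the
    observation. *)
Lemma posterior_bayes_set A : measurable A ->
  {ae P, forall w, kk (H w, y w) A = bayes g (p (H w)) (y w) A}.
Proof.
move=> mA; have kb := sub_kernel_bayes g kp.
pose f sy := bayes g (p sy.1) sy.2 A.
have mf : measurable_fun [set: S * Y] f by exact: kb.1.
have mk : measurable_fun [set: S * Y] (kk ^~ A) by exact: kkk.1.
have f0 sy : 0 <= f sy by exact: measure_ge0.
have k0 sy : 0 <= kk sy A by exact: measure_ge0.
have mxA : measurable (x @^-1` A) by rewrite -[X in measurable X]setTI; exact: mx.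
pose m1 := image_measure (mrestr P mxA) mHy.
have m1E E : measurable E -> m1 E = \int[law]_(sy in E) kk sy A.
  move=> mE; rewrite integral_law// /m1 image_measureE//.
  exact: post.
have m1f : m1 [set: S * Y] < +oo.
  rewrite /m1 image_measureE//; apply: le_lt_trans (ltry 1).
  apply: probability_le1; apply: measurableI => //.
  by rewrite -[X in measurable X]setTI; exact: mHy.
have m12 : forall E, measurable E -> m1 E = density law f0 mf E.
  apply: eq_measure_rectangles => // B C mB mC.
  have mBC : measurable (B `*` C) by exact: measurableX.
  rewrite /m1 image_measureE// -[RHS]/(\int[law]_(sy in B `*` C) f sy) integral_law//.
  transitivity (P (H @^-1` B `&` (x @^-1` A `&` y @^-1` C))).
    by rewrite /mrestr; congr (P _); apply/seteqP; split => w /=; tauto.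
  rewrite joint// [LHS]integral_indicE [RHS]integral_indicE.
  transitivity (\int[P]_w ((\1_(B `*` C) (H w, y w))%:E * f (H w, y w))); last first.
    by apply: eq_integral => w _; rewrite !indicE; congr (_%:R%:E * _); exact/idP/idP.
  rewrite (observation_integral (h := fun sy => (\1_(B `*` C) sy)%:E * f sy)); last 2 first.
  - by move=> sy; rewrite mule_ge0// lee_fin.
  - by apply: emeasurable_funM => //; exact: measurable_EFin_indic.
  apply: eq_integral => w _.
  have pAfin : mrestr (p (H w)) mA [set: X] < +oo.
    apply: le_lt_trans (pfin (H w)).
    by apply: le_measure; rewrite ?inE//; exact: measurableI.
  transitivity ((\1_(H @^-1` B) w)%:E * \int[lam]_(y in C) evidence g (mrestr (p (H w)) mA) y).
    congr (_ * _).
    rewrite integral_evidence_set//.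
    by rewrite integral_mrestr//; exact: measurable_kernel.
  have evA z : evidence g (mrestr (p (H w)) mA) z = \int[p (H w)]_(x in A) (g x z)%:E.
    rewrite /evidence integral_mrestr//; first by move=> t; rewrite lee_fin lik_ge0.
    exact: measurable_lik1.
  have mevA : measurable_fun [set: Y] (evidence g (mrestr (p (H w)) mA)).
    exact: measurable_evidence.
  rewrite -ge0_integralZl//; last 2 first.
  - exact: measurable_funTS.
  - by move=> z _; exact: evidence_ge0.
  rewrite integral_indicE; apply: ge0_ae_eq_integral => //.
  - apply: emeasurable_funM; first exact: measurable_EFin_indic.
    by apply: emeasurable_funM.
  - apply: emeasurable_funM; last exact: measurable_evidence.
    apply: (measurableT_comp (f := fun sy => (\1_(B `*` C) sy)%:E * f sy)).
      by apply: emeasurable_funM => //; exact: measurable_EFin_indic.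
    exact: pair1_measurable.
  - by move=> z _; rewrite !mule_ge0 ?lee_fin ?evidence_ge0.
  - by move=> z _; rewrite !mule_ge0 ?lee_fin ?evidence_ge0.
  - apply: filterS (ae_evidence_lty g (pfin (H w))) => z zfin _.
    rewrite evA -bayes_mul_evidence// /f /= !muleA; congr (_ * _ * _).
    by rewrite -EFinM !indicE -natrM mulnb in_setX /= andbC.
have : ae_eq law setT f (kk ^~ A).
  apply: integral_ae_eq => //.
  - apply/integrableP; split => //.
    under eq_integral do rewrite gee0_abs//.
    by rewrite -[ltLHS]/(density law f0 mf setT) -m12.
  - by move=> E _ mE; rewrite -m1E// m12.
move=> [N [mN N0 subN]].
exists ((fun w => (H w, y w)) @^-1` N); split.
- by rewrite -[X in measurable X]setTI; exact: mHy.
- by rewrite -image_measureE.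
- move=> w /= kf; apply: subN => /= /(_ Logic.I) /esym; exact: kf.
Qed.

(** Countably many sets decide equality of measures, so the exceptional events of
    [posterior_bayes_set] can be collected in one. *)
Lemma posterior_bayes (C : nat -> set X) : tv_generating R C ->
  {ae P, forall w A, measurable A -> kk (H w, y w) A = bayes g (p (H w)) (y w) A}.
Proof.
move=> gC; have [mC _] := gC.
have aeC := ae_foralln (fun k => posterior_bayes_set (mC k)).
have aeCC := ae_foralln (fun k => posterior_bayes_set (measurableC (mC k))).
have aeT := posterior_bayes_set measurableT.
apply: filterS3 aeC aeCC aeT => w wC wCC wT A mA.
apply: (eq_measure_tv_generating gC) => //.
- exact: sub_kernel_fin kkk _.
- exact: le_lt_trans (bayes_le1 _ _ _) (ltry _).
Qed.

Variable r : S -> {measure set X -> \bar R}.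
Hypotheses (kr : sub_kernel r).

(** The exceptional observations are those of evidence 0 or infinite under r.
    Infinite evidence is lam-null, and evidence 0 under r entails evidence 0 under
    p by domination, so [observation_ae] applies. *)
Lemma posterior_dominates :
  {ae P, forall w, r (H w) [set: X] = 1 /\ p (H w) `<< r (H w)} ->
  {ae P, forall w, bayes g (r (H w)) (y w) [set: X] = 1 /\
    bayes g (p (H w)) (y w) `<< bayes g (r (H w)) (y w)}.
Proof.
move=> rH; pose ev sy := evidence g (r sy.1) sy.2.
pose D := ev @^-1` [set 0] `|` ev @^-1` [set +oo].
have mev : measurable_fun [set: S * Y] ev by exact: sub_kernel_evidence.
have lik0 z t : 0 <= (g t z)%:E by rewrite lee_fin lik_ge0.
have mD : measurable D.
  by apply: measurableU; rewrite -[X in measurable X]setTI;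
    apply: mev => //; exact: emeasurable_set1.
have DN : {ae P, forall w, ~ D (H w, y w)}.
  apply: (observation_ae mD); apply: filterS rH => w [_ pr].
  apply: filterS (ae_evidence_lty g (sub_kernel_fin kr (H w))) => z zfin [z0|zy].
    exact: (null_dominates_integral_eq0 pr measurableT
      (lik0 z) (measurable_lik1 g z) z0).
  by move: zfin; rewrite -[evidence _ _ _]/(ev (H w, z)) zy ltxx.
apply: filterS2 DN rH => w wD [_ pr].
have evfin : evidence g (r (H w)) (y w) < +oo.
  by rewrite ltey; apply/eqP => e; apply: wD; right.
have ev0 : 0 < evidence g (r (H w)) (y w).
  by rewrite lt0e evidence_ge0 andbT; apply/eqP => e; apply: wD; left.
split; first by rewrite bayes_setT ?ev0.
apply/null_content_dominatesP => A mA rA.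
have pA : \int[p (H w)]_(x in A) (g x (y w))%:E = 0.
  apply: (null_dominates_integral_eq0 pr) => //; first exact: measurable_lik1.
  by rewrite -bayes_mul_evidence// [X in X * _]rA mul0e.
by rewrite /= /bayes pA mul0e; case: ifP.
Qed.

(** The true posterior is the Bayes update of p, so the integrand is a function of
    H and y; conditioning on H turns its expectation into the integral of
    [integral_tv_dist_bayes_le]. *)
Lemma posterior_tv_dist_le (C : nat -> set X) : tv_generating R C ->
  {ae P, forall w, r (H w) [set: X] = 1} ->
  \int[P]_w tv_dist (kk (H w, y w)) (bayes g (r (H w)) (y w)) <=
  (2%:E - dobrushin Q) * \int[P]_w tv_dist (p (H w)) (r (H w)).
Proof.
move=> gC rH; have kbp := sub_kernel_bayes g kp; have kbr := sub_kernel_bayes g kr.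
pose h sy := tv_dist (bayes g (p sy.1) sy.2) (bayes g (r sy.1) sy.2).
have mh : measurable_fun [set: S * Y] h by exact: measurable_tv_dist gC kbp kbr.
have h0 sy : 0 <= h sy by exact: tv_dist_ge0.
have -> : \int[P]_w tv_dist (kk (H w, y w)) (bayes g (r (H w)) (y w)) =
    \int[P]_w h (H w, y w).
  apply: ge0_ae_eq_integral.
  - exact: measurableT.
  - exact: (measurableT_comp (measurable_tv_dist gC kkk kbr) mHy).
  - exact: (measurableT_comp mh mHy).
  - by move=> w _; exact: tv_dist_ge0.
  - by move=> w _; exact: h0.
  - by apply: filterS (posterior_bayes gC) => w kE _; exact: tv_dist_ext.
rewrite observation_integral//.
have mtv : measurable_fun [set: Omega] (fun w => tv_dist (p (H w)) (r (H w))).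
  exact: (measurableT_comp (measurable_tv_dist gC kp kr) mH).
have [w0 _] := measure1_nonempty (probability_setT P).
have d0 := two_sub_dobrushin_ge0 Q (x w0).
rewrite -ge0_integralZl//; last by move=> w _; exact: tv_dist_ge0.
apply: ae_ge0_le_integral => //.
- by move=> w _; apply: integral_ge0 => z _; rewrite mule_ge0 ?evidence_ge0.
- exact: measurable_marginal.
- by move=> w _; exact: mule_ge0 d0 (tv_dist_ge0 _ _).
- exact: measurable_funeM.
apply: filterS rH => w r1 _.
have mhw := measurableT_comp mh (pair1_measurable (H w)).
exact: integral_tv_dist_bayes_le (p1 _) r1 mhw.
Qed.

End bayes_step.

(** * The filter of the process *)

Section filter_recursion_lemmas.
Context dX dY (X : measurableType dX) (Y : measurableType dY) (R : realType).
Variables (T : R.-pker X ~> X) (Q : R.-pker X ~> Y).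
Variables (lam : probability Y R) (g : likelihood Q lam).

(** If T x A vanishes for r-almost every x, it vanishes for p-almost every x. *)
Lemma predict_dominates (p r : {measure set X -> \bar R}) :
  p `<< r -> predict T p `<< predict T r.
Proof.
move=> pr; apply/null_content_dominatesP => A mA.
by apply: null_dominates_integral_eq0 => //; exact: measurable_kernel.
Qed.

Lemma eq_filter_rec nu (y y' : nat -> Y) n :
  (forall i, (i <= n)%N -> y i = y' i) ->
  filter_rec T g nu y n = filter_rec T g nu y' n.
Proof.
elim: n => [|n ih] yy' /=; first by rewrite (yy' 0%N (leqnn 0)).
by rewrite (yy' n.+1 (leqnn _)) (ih (fun i le_in => yy' i (leqW le_in))).
Qed.

Lemma sub_kernel_filter_rec dS (S : measurableType dS) (nu : probability X R)
    (ys : S -> nat -> Y) n : (forall i, measurable_fun [set: S] (ys ^~ i)) ->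
  sub_kernel (fun s => filter_rec T g nu (ys s) n).
Proof.
move=> mys; elim: n => [|n ih] /=.
  have k : sub_kernel (fun _ : unit => nu : {measure set X -> \bar R}).
    by apply: sub_kernel_cst; exact: (probability_le1 nu measurableT).
  apply: (sub_kernel_comp (f := fun s => (tt, ys s 0%N)) _ (sub_kernel_bayes g k)).
  by apply/measurable_fun_pairP; split; [exact: measurable_cst|exact: mys].
apply: (sub_kernel_comp (f := fun s => (s, ys s n.+1)) _
  (sub_kernel_bayes g (sub_kernel_predict T ih))).
by apply/measurable_fun_pairP; split; [exact: measurable_id|exact: mys].
Qed.

Lemma joint_law_setX (pi : {measure set X -> \bar R}) A C :
  measurable A -> measurable C ->
  joint_law Q pi (A `*` C) = \int[pi]_(x in A) Q x C.
Proof.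
move=> mA mC; rewrite [RHS]integral_indicE; apply: eq_integral => x _.
rewrite indicE; case: (boolP (x \in A)) => xA; rewrite ?mul1e ?mul0e.
  rewrite (eq_integral (fun y => (\1_C y)%:E)) ?integral_indic ?setIT// => y _.
  by rewrite !indicE in_setX /= xA.
by rewrite integral0_eq// => y _; rewrite indicE in_setX /= (negbTE xA).
Qed.

End filter_recursion_lemmas.

Section tuples.
Context d (Y : measurableType d).

Lemma measurable_nth (y0 : Y) n i :
  measurable_fun [set: n.-tuple Y] (fun t : n.-tuple Y => nth y0 t i).
Proof.
have [lt_in|le_ni] := ltnP i n.
  rewrite (_ : (fun _ => _) = (@tnth n Y ^~ (Ordinal lt_in))).
    exact: measurable_tnth.
  by apply/funext => t; rewrite (tnth_nth y0).
rewrite (_ : (fun _ => _) = cst y0); first exact: measurable_cst.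
by apply/funext => t; rewrite nth_default// size_tuple.
Qed.

Lemma measurable_rcons_tuple n :
  measurable_fun [set: n.-tuple Y * Y]
    (fun ty => rcons_tuple ty.1 ty.2 : n.+1.-tuple Y).
Proof.
apply/measurable_fun_tnthP => i.
have [lt_in|le_ni] := ltnP i n.
  rewrite (_ : _ \o _ = (@tnth n Y ^~ (Ordinal lt_in)) \o fst).
    by apply: measurableT_comp => //; exact: measurable_tnth.
  apply/funext => -[t y]; rewrite /= !(tnth_nth y) /= nth_rcons size_tuple.
  by rewrite lt_in.
rewrite (_ : _ \o _ = snd)//.
apply/funext => -[t y]; rewrite /= (tnth_nth y) /= nth_rcons size_tuple.
by rewrite ltnNge le_ni /=; case: eqP.
Qed.

Lemma measurable_split_tuple n :
  measurable_fun [set: n.+1.-tuple Y] (fun t : n.+1.-tuple Y =>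
    ([tuple tnth t (widen_ord (leqnSn n) i) | i < n], tnth t ord_max)).
Proof.
apply/measurable_fun_pairP; split; last exact: measurable_tnth.
apply/measurable_fun_tnthP => i.
rewrite (_ : _ \o _ = @tnth n.+1 Y ^~ (widen_ord (leqnSn n) i)).
  exact: measurable_tnth.
by apply/funext => t; rewrite /= tnth_mktuple.
Qed.

End tuples.

Section process_lemmas.
Context d dX dY (Omega : measurableType d) (X : measurableType dX)
  (Y : measurableType dY) (R : realType).
Variables (T : R.-pker X ~> X) (Q : R.-pker X ~> Y).
Variables (lam : probability Y R) (g : likelihood Q lam).
Variables (P : probability Omega R).
Variables (x_ : nat -> {RV P >-> X}) (y_ : nat -> {RV P >-> Y}).
Variables (mu nu : probability X R) (xy_law : pomp T Q x_ y_ mu).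
Variable pi_mu : forall n : nat, R.-pker (n.+1.-tuple Y) ~> X.
Hypothesis pi_mu_filter : is_filter x_ y_ pi_mu.

Let mx n : measurable_fun [set: Omega] (x_ n). Proof. exact: measurable_funP. Qed.
Let my n : measurable_fun [set: Omega] (y_ n). Proof. exact: measurable_funP. Qed.

Lemma measurable_measurements n : measurable_fun [set: Omega] (measurements y_ n).
Proof.
apply/measurable_fun_tnthP => i.
rewrite (_ : _ \o _ = y_ i); first exact: my.
by apply/funext => w; rewrite /= tnth_mktuple.
Qed.

Lemma nth_measurements y0 n w i : (i < n)%N -> nth y0 (measurements y_ n w) i = y_ i w.
Proof.
by move=> lt_in; rewrite (nth_mktuple _ _ (Ordinal lt_in)).
Qed.

Lemma measurementsS n w :
  measurements y_ n.+1 w = rcons_tuple (measurements y_ n w) (y_ n w).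
Proof.
apply: eq_from_tnth => i; rewrite tnth_mktuple.
transitivity (nth (y_ n w) (rcons (measurements y_ n w) (y_ n w)) i); last first.
  by rewrite (tnth_nth (y_ n w)).
rewrite nth_rcons size_tuple; case: ltnP => [lt_in|le_ni].
  by rewrite nth_measurements.
suff -> : i = n :> nat by rewrite eqxx.
by apply/eqP; rewrite eqn_leq le_ni -ltnS ltn_ord.
Qed.

Lemma split_measurements n w :
  ([tuple tnth (measurements y_ n.+1 w) (widen_ord (leqnSn n) i) | i < n],
   tnth (measurements y_ n.+1 w) ord_max) = (measurements y_ n w, y_ n w).
Proof.
by congr pair; [apply: eq_from_tnth => i|]; rewrite !tnth_mktuple.
Qed.

(** The past and the last observation are kept apart, as the Bayes step conditions
    on one and updates with the other. *)
Definition posterior_kernel n (ty : n.-tuple Y * Y) : {measure set X -> \bar R} :=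
  pi_mu n (rcons_tuple ty.1 ty.2).

Lemma sub_kernel_posterior_kernel n : sub_kernel (@posterior_kernel n).
Proof.
apply: (sub_kernel_comp _ (sub_kernel_pker (pi_mu n))).
exact: measurable_rcons_tuple.
Qed.

Lemma cond_law_posterior_kernel n :
  cond_law P (x_ n) (fun w => (measurements y_ n w, y_ n w)) (fun ty => @posterior_kernel n ty).
Proof.
move=> A E mA mE.
pose split (t : n.+1.-tuple Y) :=
  ([tuple tnth t (widen_ord (leqnSn n) i) | i < n], tnth t ord_max).
have mB : measurable (split @^-1` E).
  by rewrite -[X in measurable X]setTI; exact: measurable_split_tuple.
have preE : (fun w => (measurements y_ n w, y_ n w)) @^-1` E =
    measurements y_ n.+1 @^-1` (split @^-1` E).
  by apply/seteqP; split => w; rewrite /preimage /= /split split_measurements.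
rewrite preE (pi_mu_filter mA mB); apply: eq_integral => w _.
by rewrite /posterior_kernel -measurementsS.
Qed.

(** There are no measurements before time 0: their space is a single point, and the
    prior plays the role of the predicted law. *)
Lemma joint_law_initial B A C : measurable B -> measurable A -> measurable C ->
  P (measurements y_ 0 @^-1` B `&` (x_ 0%N @^-1` A `&` y_ 0%N @^-1` C)) =
  \int[P]_(w in measurements y_ 0 @^-1` B) \int[mu]_(x in A) Q x C.
Proof.
move=> mB mA mC.
(* a set of empty tuples is everything or nothing *)
have [B0|B0] := pselect (B [tuple]).
  have -> : measurements y_ 0 @^-1` B = setT.
    by apply/seteqP; split => // w _ /=; rewrite (tuple0 (measurements _ _ _)).
  rewrite setTI; transitivity ((\int[mu]_(x in A) Q x C) * P setT).
    rewrite probability_setT mule1.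
    by rewrite -(joint_law_setX Q mu mA mC) -(xy_law.1 _ (measurableX mA mC)).
  by rewrite -integral_cst.
have -> : measurements y_ 0 @^-1` B = set0.
  by apply/seteqP; split => // w /=; rewrite (tuple0 (measurements _ _ _)).
by rewrite set0I measure0 integral_set0.
Qed.

(** The transition law of the process gives the next state and observation in terms
    of the current state; that state is then replaced by its conditional law given
    the measurements, which produces the predicted law. *)
Lemma joint_law_next n B A C : measurable B -> measurable A -> measurable C ->
  P (measurements y_ n.+1 @^-1` B `&` (x_ n.+1 @^-1` A `&` y_ n.+1 @^-1` C)) =
  \int[P]_(w in measurements y_ n.+1 @^-1` B)
    \int[predict T (pi_mu n (measurements y_ n.+1 w))]_(x in A) Q x C.
Proof.
move=> mB mA mC.
pose obs (h : n.+1.-tuple (X * Y)) : n.+1.-tuple Y := [tuple (tnth h i).2 | i < n.+1].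
have mobs : measurable_fun [set: n.+1.-tuple (X * Y)] obs.
  apply/measurable_fun_tnthP => i.
  rewrite (_ : _ \o _ = snd \o (@tnth n.+1 (X * Y)%type ^~ i)).
    by apply: measurableT_comp => //; exact: measurable_tnth.
  by apply/funext => h; rewrite /= tnth_mktuple.
have mB' : measurable (obs @^-1` B) by rewrite -[X in measurable X]setTI; exact: mobs.
have preE : measurements y_ n.+1 @^-1` B = history x_ y_ n.+1 @^-1` (obs @^-1` B).
  have obsE w : obs (history x_ y_ n.+1 w) = measurements y_ n.+1 w.
    by apply: eq_from_tnth => i; rewrite !tnth_mktuple.
  by apply/seteqP; split => w; rewrite /preimage /= obsE.
rewrite {1}preE.
have := xy_law.2 n _ _ (measurableX mA mC) mB'.
rewrite -[X in P (_ `&` X)]/(x_ n.+1 @^-1` A `&` y_ n.+1 @^-1` C) => ->.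
rewrite -preE.
pose phi x := \int[T x]_(x' in A) Q x' C.
transitivity (\int[P]_(w in measurements y_ n.+1 @^-1` B) phi (x_ n w)).
  by apply: eq_integral => w _; rewrite joint_law_setX// tnth_mktuple.
have mQC : measurable_fun [set: X] (fun x => (\1_A x)%:E * Q x C).
  by apply: emeasurable_funM; [exact: measurable_EFin_indic|exact: measurable_kernel].
have Q0 x : 0 <= (\1_A x)%:E * Q x C by rewrite mule_ge0// lee_fin.
have phiE x : phi x = \int[T x]_x' ((\1_A x')%:E * Q x' C) by exact: integral_indicE.
have phi0 x : 0 <= phi x by apply: integral_ge0.
have mphi : measurable_fun [set: X] phi.
  rewrite (_ : phi = fun x => \int[T x]_x' ((\1_A x')%:E * Q x' C)); last exact/funext.
  by apply: measurable_fun_integral_kernel => //; exact: measurable_kernel.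
pose h (tx : n.+1.-tuple Y * X) := (\1_B tx.1)%:E * phi tx.2.
have mh : measurable_fun [set: n.+1.-tuple Y * X] h.
  apply: emeasurable_funM; last exact: measurableT_comp.
  apply: (measurableT_comp (f := fun t : n.+1.-tuple Y => (\1_B t)%:E)) => //.
  exact: measurable_EFin_indic.
have h0 tx : 0 <= h tx by rewrite mule_ge0// lee_fin.
have := cond_law_integral (@measurable_measurements n.+1) (@mx n)
  (sub_kernel_pker (pi_mu n)) (pi_mu_filter (n := n)) h0 mh.
move=> hE; rewrite [LHS]integral_indicE [RHS]integral_indicE.
transitivity (\int[P]_w h (measurements y_ n.+1 w, x_ n w)).
  by apply: eq_integral => w _; rewrite /h !indicE; congr (_%:R%:E * _); exact/idP/idP.
rewrite hE; apply: eq_integral => w _.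
rewrite /h /= ge0_integralZl// ?lee_fin//; congr (_ * _).
rewrite [RHS]integral_indicE [RHS](@integral_mixture _ _ _ _ _ (pi_mu n (measurements y_ n.+1 w)) T)//.
  by apply: eq_integral => x _; rewrite phiE.
by move=> D mD; exact: measurable_kernel.
Qed.

Lemma posterior_kernel_measurements n w :
  @posterior_kernel n (measurements y_ n w, y_ n w) = pi_mu n (measurements y_ n.+1 w).
Proof. by rewrite /posterior_kernel -measurementsS. Qed.

Variables (C : nat -> set X) (gC : tv_generating R C) (y0 : Y).

Lemma filter_dominates_step n (p r : n.-tuple Y -> {measure set X -> \bar R}) :
  sub_kernel p -> sub_kernel r -> (forall t, p t [set: X] = 1) ->
  (forall B A D, measurable B -> measurable A -> measurable D ->
    P (measurements y_ n @^-1` B `&` (x_ n @^-1` A `&` y_ n @^-1` D)) =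
    \int[P]_(w in measurements y_ n @^-1` B)
      \int[p (measurements y_ n w)]_(x in A) Q x D) ->
  {ae P, forall w, r (measurements y_ n w) [set: X] = 1 /\
    p (measurements y_ n w) `<< r (measurements y_ n w)} ->
  {ae P, forall w, bayes g (r (measurements y_ n w)) (y_ n w) [set: X] = 1 /\
    pi_mu n (measurements y_ n.+1 w) `<< bayes g (r (measurements y_ n w)) (y_ n w)}.
Proof.
move=> kp kr p1 joint rH.
have mm := @measurable_measurements n.
have := posterior_bayes g mm (@mx n) (@my n) kp p1 joint (@sub_kernel_posterior_kernel n)
  (@cond_law_posterior_kernel n) gC.
have := posterior_dominates g mm (@my n) kp p1 joint kr rH.
apply: filterS2 => w [r1 pr] piE; split => //.
apply/null_content_dominatesP => A mA rA.
rewrite -posterior_kernel_measurements piE//.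
by move/null_content_dominatesP : pr; exact.
Qed.

(** [filter_rec] reads an infinite sequence; the default y0 extends the finite
    record of measurements to one. *)
Definition observed n (t : n.-tuple Y) : nat -> Y := fun i => nth y0 t i.

Lemma filter_rec_observed n w :
  filter_rec T g nu (observed (measurements y_ n.+1 w)) n =
  filter_rec T g nu (fun i => y_ i w) n.
Proof. by apply: eq_filter_rec => i i_le; rewrite /observed nth_measurements. Qed.

Lemma filter_rec_observedS n w :
  filter_rec T g nu (fun i => y_ i w) n.+1 =
  bayes g (predict T (filter_rec T g nu (observed (measurements y_ n.+1 w)) n))
    (y_ n.+1 w).
Proof. by rewrite filter_rec_observed. Qed.

Lemma sub_kernel_observed n :
  sub_kernel (fun t : n.+1.-tuple Y => filter_rec T g nu (observed t) n).
Proof. by apply: sub_kernel_filter_rec => i; exact: measurable_nth. Qed.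

(** Induction over the time: domination is inherited by the predicted laws, and
    then by the updated ones.  The induction starts from mu << nu. *)
Lemma filter_dominates n : mu `<< nu ->
  {ae P, forall w, filter_rec T g nu (fun i => y_ i w) n [set: X] = 1 /\
    pi_mu n (measurements y_ n.+1 w) `<< filter_rec T g nu (fun i => y_ i w) n}.
Proof.
move=> mu_nu; elim: n => [|n ih].
  apply: (@filter_dominates_step 0 (fun=> mu) (fun=> nu)).
  - by apply: sub_kernel_cst; exact: probability_le1.
  - by apply: sub_kernel_cst; exact: probability_le1.
  - by move=> _; exact: probability_setT.
  - exact: joint_law_initial.
  - by apply: aeW => w; split => //; exact: probability_setT.
have := @filter_dominates_step n.+1 (fun t => predict T (pi_mu n t))
  (fun t => predict T (filter_rec T g nu (observed t) n))
  (sub_kernel_predict T (sub_kernel_pker (pi_mu n)))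
  (sub_kernel_predict T (@sub_kernel_observed n)) _ (@joint_law_next n) _.
move=> H; apply: filterS (H _ _) => [w||].
- by rewrite filter_rec_observedS.
- by move=> t; exact: etrans (predict_setT T _) (prob_kernel _).
- apply: filterS ih => w; rewrite filter_rec_observed => -[r1 pr]; split.
    exact: etrans (predict_setT T _) r1.
  exact: predict_dominates.
Qed.

(** Update bound for the predicted laws, followed by the pointwise prediction bound,
    which applies where the filter started from nu is a probability. *)
Lemma filter_stability_step n : mu `<< nu ->
  \int[P]_w tv_dist (pi_mu n.+1 (measurements y_ n.+2 w))
                    (filter_rec T g nu (fun i => y_ i w) n.+1) <=
  (1 - dobrushin T) * (2%:E - dobrushin Q) *
  \int[P]_w tv_dist (pi_mu n (measurements y_ n.+1 w))
                    (filter_rec T g nu (fun i => y_ i w) n).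
Proof.
move=> mu_nu; have mm := @measurable_measurements n.+1.
pose p (t : n.+1.-tuple Y) : {measure set X -> \bar R} := predict T (pi_mu n t).
pose rho (t : n.+1.-tuple Y) : {measure set X -> \bar R} := filter_rec T g nu (observed t) n.
pose r (t : n.+1.-tuple Y) : {measure set X -> \bar R} := predict T (rho t).
have krho : sub_kernel rho by exact: sub_kernel_observed.
have kpi := sub_kernel_pker (pi_mu n).
have kp : sub_kernel p by exact: sub_kernel_predict.
have kr : sub_kernel r by exact: sub_kernel_predict.
have p1 t : p t [set: X] = 1.
  exact: etrans (predict_setT T _) (prob_kernel _).
have rho1 : {ae P, forall w, rho (measurements y_ n.+1 w) [set: X] = 1}.
  by apply: filterS (filter_dominates n mu_nu) => w [+ _]; rewrite /rho filter_rec_observed.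
have r1 : {ae P, forall w, r (measurements y_ n.+1 w) [set: X] = 1}.
  by apply: filterS rho1 => w w1; exact: etrans (predict_setT T _) w1.
have step := posterior_tv_dist_le g mm (@mx n.+1) (@my n.+1) kp p1 (@joint_law_next n)
  (@sub_kernel_posterior_kernel n.+1) (@cond_law_posterior_kernel n.+1) kr gC r1.
have lhsE : \int[P]_w tv_dist (pi_mu n.+1 (measurements y_ n.+2 w))
                    (filter_rec T g nu (fun i => y_ i w) n.+1) =
  \int[P]_w tv_dist (@posterior_kernel n.+1 (measurements y_ n.+1 w, y_ n.+1 w))
    (bayes g (r (measurements y_ n.+1 w)) (y_ n.+1 w)).
  apply: eq_integral => w _; congr tv_dist.
    exact: esym (posterior_kernel_measurements n.+1 w).
  exact: filter_rec_observedS.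
rewrite lhsE; apply: le_trans step _.
have [w0 _] := measure1_nonempty (probability_setT P).
have dT0 := one_sub_dobrushin_ge0 T (x_ 0%N w0).
have dQ0 := two_sub_dobrushin_ge0 Q (x_ 0%N w0).
rewrite (muleC (1 - dobrushin T)) -(muleA (2%:E - dobrushin Q)).
apply: lee_wpmul2l; first exact: dQ0.
have mtv : measurable_fun [set: Omega]
    (fun w => tv_dist (pi_mu n (measurements y_ n.+1 w)) (rho (measurements y_ n.+1 w))).
  exact: (measurableT_comp (measurable_tv_dist gC kpi krho) mm).
have -> : \int[P]_w tv_dist (pi_mu n (measurements y_ n.+1 w))
      (filter_rec T g nu (fun i => y_ i w) n) =
    \int[P]_w tv_dist (pi_mu n (measurements y_ n.+1 w)) (rho (measurements y_ n.+1 w)).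
  by apply: eq_integral => w _; rewrite /rho filter_rec_observed.
rewrite -ge0_integralZl; [|exact: measurableT|exact: mtv|
  by move=> w _; exact: tv_dist_ge0|exact: dT0].
apply: ae_ge0_le_integral.
- exact: measurableT.
- by move=> w _; exact: tv_dist_ge0.
- exact: (measurableT_comp (measurable_tv_dist gC kp kr) mm).
- by move=> w _; exact: mule_ge0 dT0 (tv_dist_ge0 _ _).
- exact: measurable_funeM.
- by apply: filterS rho1 => w w1 _; exact: tv_dist_predict (prob_kernel _) w1.
Qed.

End process_lemmas.

Theorem theorem3p3 (R : realType) (X Y : ptopologicalType)
    (polishX : polish R X) (polishY : polish R Y)
    (T : R.-pker (borel X) ~> (borel X)) (Q : R.-pker (borel X) ~> (borel Y))
    (mu nu : probability (borel X) R) (mu_nu : mu `<< nu)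
    (lam : probability (borel Y) R) (Q_lam : channel_dominated Q lam)
    (g : likelihood Q lam)
    (d : measure_display) (Omega : measurableType d) (P : probability Omega R)
    (x_ : nat -> {RV P >-> borel X}) (y_ : nat -> {RV P >-> borel Y})
    (xy_law : pomp T Q x_ y_ mu)
    (pi_mu : forall n : nat, R.-pker (n.+1.-tuple (borel Y)) ~> (borel X))
    (pi_mu_filter : is_filter x_ y_ pi_mu) (n : nat) :
  \int[P]_w tv_dist (pi_mu n.+1 (measurements y_ n.+2 w))
                    (filter_rec T g nu (fun i => y_ i w) n.+1)
  <= (1 - dobrushin T) * (2%:E - dobrushin Q) *
     \int[P]_w tv_dist (pi_mu n (measurements y_ n.+1 w))
                       (filter_rec T g nu (fun i => y_ i w) n).
Proof.
have [B mB] := polish_countably_generated polishX.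
have [C gC] := countably_generated_tv R mB.
exact: (filter_stability_step g xy_law pi_mu_filter gC point n mu_nu).
Qed.
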